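(* For any maximally almost periodic group $G$ (considered as an abstract group), the lattice of Hausdorff totally bounded group topologies on $G$ is bijectively isomorphic to the lattice of representation spaces of $G$ (both ordered by inclusion); that is, there is a bijection between them that preserves inclusion in both directions.
   Context: $\mathbb U(n)$ is the unitary group of order $n$. An abstract group is maximally almost periodic (MAP) if it admits an injective homomorphism into a compact group. $G_d$ is $G$ with the discrete topology; $\mathrm{rep}_n(G_d)$ is the set of all homomorphisms $G\to\mathbb U(n)$ and $\mathrm{rep}(G_d)=\bigcup_{n<\omega}\mathrm{rep}_n(G_d)$. A group topology is totally bounded if for every neighborhood $U$ of the neutral element there is a finite $F\subseteq G$ with $FU=G$. A representation space of $G$ is a subset $\Gamma\subseteq\mathrm{rep}(G_d)$, with $\Gamma_n=\Gamma\cap\mathrm{rep}_n(G_d)$, that separates the points of $G$ (for each $x\ne e_G$ some $\varphi\in\Gamma$ has $\varphi(x)$ not the identity matrix) and satisfies: (1) $\varphi_1\in\Gamma_n$, $\varphi_2\in\Gamma_m$ imply $\varphi_1\oplus\varphi_2\in\Gamma_{n+m}$ and $\varphi_1\otimes\varphi_2\in\Gamma_{nm}$; (2) $\varphi\in\Gamma_n$, $A\in\mathbb U(n)$ imply $\overline\varphi\in\Gamma_n$ and $A^{-1}\varphi A\in\Gamma_n$; (3) if $\varphi=\bigoplus_{j=1}^m\varphi_j\in\Gamma$ then each $\varphi_j\in\Gamma$; (4) the trivial representation $1$ is in $\Gamma_1$. The word ''lattice'' is used for the family in question partially ordered by inclusion. *)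

(* Defs.v *)
From HB Require Import structures.
From mathcomp Require Import all_boot all_order all_algebra spectral.
From mathcomp Require Import all_classical reals topology.
From mathcomp Require Import complex mxtens.

Set Implicit Arguments.
Unset Strict Implicit.
Unset Printing Implicit Defensive.

Import Order.TTheory GRing.Theory Num.Theory.

Local Open Scope classical_set_scope.
Local Open Scope ring_scope.

(* Topologies on a fixed type are handled as first-class objects, so that the
   set of all of them can be ordered by inclusion of their open sets. *)
Record topology_on (T : Type) := TopologyOn {
  opens_of : set (set T);
  opens_ofT : opens_of setT;
  opens_ofI : setI_closed opens_of;
  opens_of_bigcup : forall S : set (set T),
    S `<=` opens_of -> opens_of (\bigcup_(A in S) A) }.

(* [topologized t] is an alias of G carrying its group structure together with
   the topology t. *)
Definition topologized (G : groupType) (t : topology_on G) : Type := G.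

Section Topologized.
Variables (G : groupType) (t : topology_on G).

HB.instance Definition _ := Group.on (topologized t).

Lemma opens_of_bigcupT (I : Type) (f : I -> set (topologized t)) :
  (forall i, opens_of t (f i)) -> opens_of t (\bigcup_i f i).
Proof.
move=> fop; rewrite -(bigcup_image setT f id).
by apply: opens_of_bigcup => _ [i _ <-].
Qed.

HB.instance Definition _ := isOpenTopological.Build (topologized t)
  (opens_ofT t) (@opens_ofI _ t) opens_of_bigcupT.

Lemma open_topologizedE : @open (topologized t) = opens_of t.
Proof. by []. Qed.

Definition group_topology : Prop :=
  continuous (fun xy : topologized t * topologized t =>
                (xy.1 * xy.2)%g : topologized t) /\
  continuous (fun x : topologized t => x^-1%g : topologized t).

Definition totally_bounded_topology : Prop :=
  forall U : set (topologized t), nbhs (1%g : topologized t) U ->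
    exists F : set (topologized t),
      finite_set F /\ [set (x * y)%g | x in F & y in U] = setT.

End Topologized.

Definition hausdorff_tb_group_topologies (G : groupType) :
    set (topology_on G) :=
  [set t | [/\ group_topology t, hausdorff_space (topologized t)
             & totally_bounded_topology t]].
Arguments hausdorff_tb_group_topologies : clear implicits.

(* Compact groups are Hausdorff by convention; without this the notion would be
   void, as every group is compact in the indiscrete topology. *)
Definition maximally_almost_periodic (G : groupType) : Prop :=
  exists (K : groupType) (t : topology_on K),
    [/\ group_topology t, hausdorff_space (topologized t),
        compact [set: topologized t]
      & exists f : {multiplicative G -> K}, injective f].

Section Representations.
Variables (R : realType) (G : groupType).

(* Homomorphisms into the unitary group of order n, whose degree n is required
   to be positive. *)
Definition rep_n (n : nat) : set (G -> 'M[R[i]]_n) :=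
  [set phi | [/\ (0 < n)%N, forall x, phi x \is unitarymx
               & {morph phi : x y / (x * y)%g >-> x *m y}]].

(* A map into matrices paired with its degree, so that a subset of rep(G_d),
   the disjoint union over n of the sets [rep_n n], is a single set. *)
Definition matrix_map : Type := {n : nat & G -> 'M[R[i]]_n}.

Definition rep : set matrix_map := [set u | rep_n (projT2 u)].

Definition degree_part (Gamma : set matrix_map) (n : nat) :
    set (G -> 'M[R[i]]_n) :=
  [set phi | Gamma (existT _ n phi)].

Definition rep_sum n m (phi : G -> 'M[R[i]]_n) (psi : G -> 'M[R[i]]_m) :
    G -> 'M[R[i]]_(n + m) :=
  fun x => block_mx (phi x) 0 0 (psi x).

Definition rep_bigsum m (p : 'I_m -> nat)
    (phi : forall j, G -> 'M[R[i]]_(p j)) : G -> 'M[R[i]]_(\sum_j p j) :=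
  fun x => \mxdiag_j phi j x.

Definition rep_tensor n m (phi : G -> 'M[R[i]]_n) (psi : G -> 'M[R[i]]_m) :
    G -> 'M[R[i]]_(n * m) :=
  fun x => phi x *t psi x.

Definition rep_conj n (phi : G -> 'M[R[i]]_n) : G -> 'M[R[i]]_n :=
  fun x => map_mx Num.conj (phi x).

Definition rep_similar n (A : 'M[R[i]]_n) (phi : G -> 'M[R[i]]_n) :
    G -> 'M[R[i]]_n :=
  fun x => invmx A *m phi x *m A.

Definition rep_trivial : G -> 'M[R[i]]_1 := fun=> 1%:M.

Record representation_space (Gamma : set matrix_map) : Prop := {
  rspace_sub : Gamma `<=` rep;
  rspace_separates : forall x : G, x <> 1%g ->
    exists n (phi : G -> 'M[R[i]]_n),
      degree_part Gamma phi /\ phi x <> 1%:M;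
  rspace_sum : forall n m (phi : G -> 'M[R[i]]_n) (psi : G -> 'M[R[i]]_m),
    degree_part Gamma phi -> degree_part Gamma psi ->
    degree_part Gamma (rep_sum phi psi);
  rspace_tensor : forall n m (phi : G -> 'M[R[i]]_n) (psi : G -> 'M[R[i]]_m),
    degree_part Gamma phi -> degree_part Gamma psi ->
    degree_part Gamma (rep_tensor phi psi);
  rspace_conj : forall n (phi : G -> 'M[R[i]]_n),
    degree_part Gamma phi -> degree_part Gamma (rep_conj phi);
  rspace_similar : forall n (phi : G -> 'M[R[i]]_n) (A : 'M[R[i]]_n),
    degree_part Gamma phi -> A \is unitarymx ->
    degree_part Gamma (rep_similar A phi);
  rspace_summand : forall m (p : 'I_m -> nat)
      (phi : forall j, G -> 'M[R[i]]_(p j)),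
    (forall j, rep_n (phi j)) ->
    degree_part Gamma (rep_bigsum phi) ->
    forall j, degree_part Gamma (phi j);
  rspace_trivial : degree_part Gamma rep_trivial }.

End Representations.

(* Main.v *)
(* A Hausdorff totally bounded group topology is sent to the set of its
   continuous unitary representations, and a representation space Gamma to the
   initial topology it induces.

   The first composite is the identity by Peter-Weyl.  No completion or Haar
   measure is needed: on the bi-uniformly continuous functions of a totally
   bounded group, von Neumann's finite averages define an invariant mean, hence
   an inner product.  Convolution by a symmetric kernel is compact and
   symmetric, its eigenspaces are finite-dimensional and translation invariant,
   so they consist of coefficients of orthogonal representations; for a kernel k
   supported near 1 this approximates k * k * k uniformly by coefficients, and a
   coefficient close to it detects a neighborhood of 1.

   The second composite is the identity by Schur's lemma.  If phi is irreducible
   and continuous for the topology induced by Gamma, some psi of degree m in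
   Gamma is such that Re tr phi > 0 wherever psi is near 1.  The powers of
   2 m + 2 Re tr psi are characters of members of Gamma that concentrate there,
   so one of them is not orthogonal to the character of phi; this gives an
   intertwiner, and phi embeds in that member of Gamma. *)
From HB Require Import structures.
Require Import Defs.
From mathcomp Require Import all_boot all_order all_algebra spectral.
From mathcomp Require Import all_classical reals topology.
From mathcomp Require Import ereal normedtype sequences complex mxtens.
From mathcomp Require Import ring lra.

Set Implicit Arguments.
Unset Strict Implicit.
Unset Printing Implicit Defensive.

Import Order.TTheory GRing.Theory Num.Theory numFieldNormedType.Exports.

Local Open Scope classical_set_scope.
Local Open Scope ring_scope.

(** * Invariant means on totally bounded groups *)

(** The functions satisfying [ucont], with the inner product [dot], need not form a complete space,
    and this shapes the analysis: an L2 extremal problem need not have a solution among them. Every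
    extremal sequence is therefore pushed through [conv k], which turns an L2 bound into
    equicontinuity, and finite covers then give a uniform accumulation point ([conv_precompact]).
    One convolution is spent on making residuals accumulate, a second one annihilates the
    accumulation point: this is why only twice convolved functions are approximated, and why a
    kernel k enters as k * k * k. On the representation side a single real function does the work:
    [defect phi x], the squared Frobenius distance from [phi x] to the identity. It is invariant
    under inversion and conjugation, additive on direct sums, and equal to 2 n - 2 Re tr (phi x) in
    degree n, so it describes neighborhoods and characters at once. Injectivity of the
    correspondence comes from the equivalence of the two inclusions, by antisymmetry. *)

Record tb_filter (G : groupType) (N : set (set G)) : Prop := TBFilter {
  tbf_filter : Filter N;
  tbf_one : forall V, N V -> V 1%g;
  tbf_mul : forall V, N V ->
    exists2 W, N W & forall x y, W x -> W y -> V (x * y)%g;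
  tbf_inv : forall V, N V -> N [set x | V x^-1%g];
  (* Uniform in the conjugating element: the left and right uniformities coincide. For neighborhoods
     of 1 this is a consequence of total boundedness, see [nbhs_tb_filter]. *)
  tbf_conj : forall V, N V ->
    exists2 W, N W & forall x y, W y -> V (x * y * x^-1)%g;
  tbf_cover : forall V, N V ->
    exists F : seq G, forall x, exists2 s, s \in F & V (s^-1 * x)%g }.

Section UniformFunctions.
Variables (R : realType) (G : groupType) (N : set (set G)).
Hypothesis tbN : tb_filter N.
Implicit Types (f g h : G -> R) (S T : seq G).

Let filtN : Filter N := tbf_filter tbN.
#[local] Existing Instance filtN.

(* Inserting [v] in the middle makes the class visibly stable under left and
   right translations and inversion. *)
Definition ucont f : Prop := forall e, 0 < e ->
  exists2 V, N V & forall x v y, V v -> `|f (x * v * y)%g - f (x * y)%g| <= e.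

Lemma ucont_cst c : ucont (fun=> c).
Proof. by move=> e e0; exists setT; [exact: filterT|move=> *;
  rewrite subrr normr0 ltW]. Qed.

Lemma ucont_bounded f : ucont f -> exists2 B, 0 < B & forall x, `|f x| <= B.
Proof.
move=> /(_ 1 ltr01)[V NV fV]; have [F FV] := tbf_cover tbN NV.
exists (1 + \sum_(s <- F) `|f s|).
  by apply: ltr_pwDl => //; apply: sumr_ge0 => *; exact: normr_ge0.
move=> x; have [s sF Vs] := FV x.
have := fV s _ 1%g Vs; rewrite !mulg1 mulVKg => fxs.
have : `|f s| <= \sum_(s <- F) `|f s|.
  by rewrite (big_rem s)//= lerDl; apply: sumr_ge0 => *; exact: normr_ge0.
by move: fxs; have := lerB_dist (f x) (f s); lra.
Qed.

Lemma ucontD f g : ucont f -> ucont g -> ucont (fun x => f x + g x).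
Proof.
move=> uf ug e e0; have e2 : 0 < e / 2 by lra.
have [V NV fV] := uf _ e2; have [W NW gW] := ug _ e2.
exists (V `&` W); first exact: filterI.
move=> x v y [Vv Wv]; have := fV x v y Vv; have := gW x v y Wv.
rewrite !ler_norml => /andP[? ?] /andP[? ?]; apply/andP; split; lra.
Qed.

Lemma ucontM f g : ucont f -> ucont g -> ucont (fun x => f x * g x).
Proof.
move=> uf ug e e0.
have [B B0 fB] := ucont_bounded uf; have [C C0 gC] := ucont_bounded ug.
have e1 : 0 < e / (2 * C) by rewrite divr_gt0// mulr_gt0.
have e2 : 0 < e / (2 * B) by rewrite divr_gt0// mulr_gt0.
have [V NV fV] := uf _ e1; have [W NW gW] := ug _ e2.
exists (V `&` W); first exact: filterI.
move=> x v y [Vv Wv]; have fv := fV x v y Vv; have gv := gW x v y Wv.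
set a := f (x * v * y)%g in fv *; set b := f (x * y)%g in fv *.
set c := g (x * v * y)%g in gv *; set d := g (x * y)%g in gv *.
have -> : a * c - b * d = (a - b) * c + b * (c - d) by ring.
rewrite (le_trans (ler_normD _ _))// !normrM.
have -> : e = e / (2 * C) * C + B * (e / (2 * B)).
  by field; rewrite !gt_eqF.
by apply: lerD; apply: ler_pM => //; [exact: gC|exact: fB].
Qed.

Lemma ucontZ c f : ucont f -> ucont (fun x => c * f x).
Proof. by move=> uf; exact: (ucontM (ucont_cst c) uf). Qed.

Lemma ucontN f : ucont f -> ucont (fun x => - f x).
Proof.
move=> uf e e0; have [V NV fV] := uf e e0; exists V => // x v y Vv.
by rewrite -opprD normrN; exact: fV.
Qed.

Lemma ucontB f g : ucont f -> ucont g -> ucont (fun x => f x - g x).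
Proof. by move=> uf ug; exact: (ucontD uf (ucontN ug)). Qed.

Lemma ucont_sum I (r : seq I) (F : I -> G -> R) :
  (forall i, ucont (F i)) -> ucont (fun x => \sum_(i <- r) F i x).
Proof.
move=> uF; elim: r => [|i r IH].
  rewrite (_ : (fun _ => _) = fun=> 0); first exact: ucont_cst.
  by apply/funext => x; rewrite big_nil.
rewrite (_ : (fun _ => _) = fun x => F i x + \sum_(j <- r) F j x).
  exact: ucontD.
by apply/funext => x; rewrite big_cons.
Qed.

Lemma ucont_exp f n : ucont f -> ucont (fun x => f x ^+ n).
Proof.
move=> uf; elim: n => [|n IH]; first exact: ucont_cst.
rewrite (_ : (fun _ => _) = fun x => f x * f x ^+ n); first exact: ucontM.
by apply/funext => x; rewrite exprS.
Qed.

Lemma ucont_translate f a b : ucont f -> ucont (fun x => f (a * x * b)%g).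
Proof.
move=> uf e e0; have [V NV fV] := uf e e0; exists V => // x v y Vv.
by have := fV (a * x)%g v (y * b)%g Vv; rewrite !mulgA.
Qed.

Lemma ucont_mulr f b : ucont f -> ucont (fun x => f (x * b)%g).
Proof.
move=> /(ucont_translate 1%g b);
  rewrite (_ : (fun _ => _) = fun x => f (x * b)%g)//.
by apply/funext => x; rewrite mul1g.
Qed.

Lemma ucont_mull f a : ucont f -> ucont (fun x => f (a * x)%g).
Proof.
move=> /(ucont_translate a 1%g);
  rewrite (_ : (fun _ => _) = fun x => f (a * x)%g)//.
by apply/funext => x; rewrite mulg1.
Qed.

Lemma ucont_inv f : ucont f -> ucont (fun x => f x^-1%g).
Proof.
move=> uf e e0; have [V NV fV] := uf e e0.
exists [set x | V x^-1%g]; first exact: tbf_inv tbN _ NV.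
by move=> x v y /= Vv; have := fV y^-1%g v^-1%g x^-1%g Vv;
  rewrite !invgM !mulgA.
Qed.

Lemma ucont_lim f :
  (forall e, 0 < e -> exists2 g, ucont g & forall x, `|f x - g x| <= e) ->
  ucont f.
Proof.
move=> fg e e0; have e3 : 0 < e / 3 by lra.
have [g ug fge] := fg _ e3; have [V NV gV] := ug _ e3; exists V => // x v y Vv.
have := gV x v y Vv; have := fge (x * v * y)%g; have := fge (x * y)%g.
rewrite !ler_norml => /andP[? ?] /andP[? ?] /andP[? ?]; apply/andP; split; lra.
Qed.

Lemma ucont_max0 f : ucont f -> ucont (fun x => Num.max 0 (f x)).
Proof.
move=> uf e e0; have [V NV fV] := uf e e0; exists V => // x v y Vv.
have := fV x v y Vv; rewrite !ler_norml => /andP[].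
case: (leP 0 (f (x * v * y)%g)) => ?; case: (leP 0 (f (x * y)%g)) => ? ? ?.
- by apply/andP; split; lra.
- by apply/andP; split; lra.
- by apply/andP; split; lra.
- by apply/andP; split; lra.
Qed.

Definition avg S f (x : G) : R := (size S)%:R^-1 * \sum_(s <- S) f (x * s)%g.
Definition lavg S f (x : G) : R := (size S)%:R^-1 * \sum_(s <- S) f (s * x)%g.

Lemma size_gt0 S : S != [::] -> 0 < (size S)%:R :> R.
Proof. by case: S => // *; rewrite ltr0n. Qed.

Lemma sumr_const_seq I (r : seq I) (c : R) : \sum_(i <- r) c = c *+ size r.
Proof. by rewrite big_const_seq count_predT iter_addr_0. Qed.

Lemma avg_cst S c x : S != [::] -> avg S (fun=> c) x = c.
Proof.
move=> /size_gt0 S0; rewrite /avg sumr_const_seq -(mulr_natr c) mulrCA mulVf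
  ?mulr1//.
exact: lt0r_neq0.
Qed.

Lemma avgD S f g x : avg S (fun y => f y + g y) x = avg S f x + avg S g x.
Proof. by rewrite /avg big_split mulrDr. Qed.

Lemma avgZ S c f x : avg S (fun y => c * f y) x = c * avg S f x.
Proof. by rewrite /avg -mulr_sumr mulrCA. Qed.

Lemma le_avg S f g x : (forall y, f y <= g y) -> avg S f x <= avg S g x.
Proof.
by move=> fg; rewrite ler_wpM2l ?invr_ge0// ler_sum.
Qed.

Lemma avg_dist S f c e : S != [::] ->
  (forall x, `|f x - c| <= e) -> forall x, `|avg S f x - c| <= e.
Proof.
move=> S0 fc x; rewrite ler_distl.
apply/andP; split.
  rewrite -[leLHS](avg_cst _ x S0); apply: le_avg => y.
  by have := fc y; rewrite ler_distl => /andP[].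
rewrite -[leRHS](avg_cst _ x S0); apply: le_avg => y.
by have := fc y; rewrite ler_distl => /andP[].
Qed.

Lemma avg_lavg S f x :
  lavg S f x = avg [seq s^-1%g | s <- S] (fun y => f y^-1%g) x^-1%g.
Proof.
rewrite /lavg /avg size_map big_map; congr (_ * _); apply: eq_bigr => s _.
by rewrite invgM !invgK.
Qed.

Lemma avg_comp S T f x :
  avg S (avg T f) x = avg [seq (s * t)%g | s <- S, t <- T] f x.
Proof.
rewrite /avg size_allpairs natrM invfM -mulrA; congr (_ * _).
rewrite big_allpairs_dep mulr_sumr; apply: eq_bigr => s _; congr (_ * _).
by apply: eq_bigr => t _; rewrite mulgA.
Qed.

Lemma avg_allpairs_neq0 S T : S != [::] -> T != [::] ->
  [seq (s * t)%g | s <- S, t <- T] != [::].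
Proof. by rewrite -!size_eq0 size_allpairs muln_eq0 => /negPf-> /negPf->. Qed.

Lemma ucont_avg S f : ucont f -> ucont (avg S f).
Proof. by move=> uf; apply: ucontZ; apply: ucont_sum => s;
  exact: ucont_mulr. Qed.

(** Infimum over the families S of the supremum of [avg S f], with upper bounds in place of the
    supremum. *)
Definition mean f : R :=
  inf [set c | exists2 S, S != [::] & forall x, avg S f x <= c].

(* Von Neumann's argument: an average whose supremum nearly attains the infimum
   over all averages is nearly constant, since averaging it again over a finite
   cover would otherwise lower the supremum. *)
Lemma avg_mean f : ucont f -> forall e, 0 < e ->
  exists2 S, S != [::] & forall x, `|avg S f x - mean f| <= e.
Proof.
move=> uf e e0; rewrite /mean; set A := (X in inf X).
have [B B0 fB] := ucont_bounded uf.
have infA : has_inf A.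
  split.
    exists B, [:: 1%g] => // x; rewrite -(avg_cst B x (isT : [:: 1%g] != [::])).
    by apply: le_avg => y; rewrite (le_trans (ler_norm _)).
  exists (- B) => c [S S0 Sc]; rewrite (le_trans _ (Sc 1%g))//.
  rewrite -(avg_cst (- B) 1%g S0); apply: le_avg => y.
  by have := fB y; rewrite ler_norml => /andP[].
have e2 : 0 < e / 2 by lra.
have [V NV fV] := uf _ e2; have [F FV] := tbf_cover tbN NV.
have F0 : F != [::] by case: F FV => // /(_ 1%g)[].
pose n : R := (size F)%:R; have n1 : 1 <= n by rewrite ler1n lt0n size_eq0.
have h0 : 0 < e / (2 * n) by rewrite divr_gt0//; lra.
have [c [S S0 Sc] cA] := inf_adherent h0 infA.
exists S => // x0; set m := inf A in cA *.
have hn : e / (2 * n) <= e / 2.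
  by rewrite ler_pM2l// lef_pV2 ?posrE; lra.
rewrite ler_distl; apply/andP; split; last first.
  by have := Sc x0; lra.
rewrite leNgt; apply/negP => lt0.
(* At every x one of the n translates by [F] is at most m - e / 2, which lowers the average by e /
   (2 n): exactly the excess granted to [S]. The remaining e / (2 n) / n brings the upper bound
   strictly below the infimum. *)
suff : A (m + e / (2 * n) - e / (2 * n) / n - e / (2 * n)).
  have h3 : 0 < e / (2 * n) / n by rewrite divr_gt0//; lra.
  by move=> /(ge_inf infA.2); rewrite -/m; lra.
exists [seq (s * t)%g | s <- F, t <- S]; first exact: avg_allpairs_neq0.
move=> x; rewrite -avg_comp.
have [s sF Vs] := FV (x^-1 * x0)%g.
have lts : avg S f (x * s)%g <= m - e / 2.
  suff : `|avg S f x0 - avg S f (x * s)%g| <= e / 2.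
    by rewrite ler_norml => /andP[]; lra.
  rewrite /avg -mulrBr -sumrB normrM ger0_norm ?invr_ge0// mulrC.
  rewrite ler_pdivrMr ?size_gt0// (le_trans (ler_norm_sum _ _ _))//.
  have -> : e / 2 * (size S)%:R = \sum_(t <- S) (e / 2).
    by rewrite sumr_const_seq mulr_natr.
  apply: ler_sum => t _; have := fV (x * s)%g _ t Vs.
  by rewrite -!mulgA !mulVKg.
rewrite {1}/avg (big_rem s)//= mulrC ler_pdivrMr ?size_gt0// -/n.
have : \sum_(y <- rem s F) avg S f (x * y)%g <= (n - 1) * (m + e / (2 * n)).
  rewrite -[n - 1]/(_) (_ : n - 1 = (size (rem s F))%:R); last first.
    rewrite size_rem// -subn1 natrB// lt0n size_eq0//.
  rewrite mulrC mulr_natr -sumr_const_seq; apply: ler_sum => t _.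
  by have := Sc (x * t)%g; lra.
have -> : (m + e / (2 * n) - e / (2 * n) / n - e / (2 * n)) * n
   = (n - 1) * (m + e / (2 * n)) + (m + e / (2 * n) - e / (2 * n) - e / 2).
  by field; rewrite gt_eqF//; lra.
lra.
Qed.

End UniformFunctions.

(** * Uniqueness, invariance, linearity and Fubini for the mean *)

Section Mean.
Variables (R : realType) (G : groupType) (N : set (set G)).
Hypothesis tbN : tb_filter N.
Implicit Types (f g h : G -> R) (S T : seq G).

Let filtN : Filter N := tbf_filter tbN.
#[local] Existing Instance filtN.
Local Notation ucont := (ucont N).

Lemma eqr_dist_le (a b : R) : (forall e, 0 < e -> `|a - b| <= e) -> a = b.
Proof.
move=> ab; apply/eqP; rewrite -subr_eq0 -normr_eq0 eq_le normr_ge0 andbT.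
by apply/ler_addgt0Pl => e e0; rewrite addr0 ab.
Qed.

Lemma lavg_dist S f c e : S != [::] ->
  (forall x, `|f x - c| <= e) -> forall x, `|lavg S f x - c| <= e.
Proof.
move=> S0 fc x; rewrite avg_lavg; apply: avg_dist => //.
by rewrite -size_eq0 size_map size_eq0.
Qed.

Lemma avg_lavgC S T f x : avg S (lavg T f) x = lavg T (avg S f) x.
Proof.
rewrite /avg /lavg -!mulr_sumr mulrCA exchange_big /=; do 2!congr (_ * _).
by apply: eq_bigr => t _; apply: eq_bigr => s _; rewrite mulgA.
Qed.

(** Left and right averages commute: applying to f both a left average close to c and a right
    average close to [mean f] gives one function close to both constants. Invariance and linearity
    of the mean all go through this uniqueness and its mirror image [mean_uniqr]. *)
Lemma mean_uniql f c : ucont f -> (forall e, 0 < e ->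
    exists2 S, S != [::] & forall x, `|lavg S f x - c| <= e) -> mean f = c.
Proof.
move=> uf fc; apply: eqr_dist_le => e e0; have e2 : 0 < e / 2 by lra.
have [S S0 Sc] := fc _ e2; have [T T0 Tf] := avg_mean tbN uf e2.
have := avg_dist T0 Sc 1%g; have := lavg_dist S0 Tf 1%g.
rewrite avg_lavgC !ler_norml => /andP[? ?] /andP[? ?]; apply/andP; split; lra.
Qed.

Lemma mean_inv f : ucont f -> mean (fun x => f x^-1%g) = mean f.
Proof.
move=> uf; symmetry; apply: mean_uniql => // e e0.
have [S S0 Sf] := avg_mean tbN (ucont_inv tbN uf) e0.
exists [seq s^-1%g | s <- S]; first by rewrite -size_eq0 size_map size_eq0.
move=> x; rewrite avg_lavg -map_comp (eq_map (g := id)) ?map_id;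
  first exact: Sf.
by move=> s /=; rewrite invgK.
Qed.

Lemma lavg_mean f : ucont f -> forall e, 0 < e ->
  exists2 S, S != [::] & forall x, `|lavg S f x - mean f| <= e.
Proof.
move=> uf e e0; have [S S0 Sf] := avg_mean tbN (ucont_inv tbN uf) e0.
exists [seq s^-1%g | s <- S]; first by rewrite -size_eq0 size_map size_eq0.
move=> x; rewrite -(mean_inv uf) avg_lavg -map_comp (eq_map (g := id)) ?map_id.
  exact: Sf.
by move=> s /=; rewrite invgK.
Qed.

Lemma mean_uniqr f c : ucont f -> (forall e, 0 < e ->
    exists2 S, S != [::] & forall x, `|avg S f x - c| <= e) -> mean f = c.
Proof.
move=> uf fc; apply: eqr_dist_le => e e0; have e2 : 0 < e / 2 by lra.
have [S S0 Sc] := fc _ e2; have [T T0 Tf] := lavg_mean uf e2.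
have := lavg_dist T0 Sc 1%g; have := avg_dist S0 Tf 1%g.
rewrite avg_lavgC !ler_norml => /andP[? ?] /andP[? ?]; apply/andP; split; lra.
Qed.

Lemma mean_cst c : mean (fun _ : G => c : R) = c.
Proof.
apply: mean_uniqr => [|e e0]; first exact: ucont_cst.
by exists [:: 1%g] => // x; rewrite avg_cst// subrr normr0 ltW.
Qed.

Lemma mean_mulr f b : ucont f -> mean (fun x => f (x * b)%g) = mean f.
Proof.
move=> uf; apply: mean_uniql => [|e /(lavg_mean uf)[S S0 Sf]].
  exact: ucont_mulr.
by exists S => // x; have := Sf (x * b)%g; rewrite /lavg;
  under eq_bigr do rewrite mulgA.
Qed.

Lemma mean_mull f a : ucont f -> mean (fun x => f (a * x)%g) = mean f.
Proof.
move=> uf; apply: mean_uniqr => [|e /(avg_mean tbN uf)[S S0 Sf]].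
  exact: ucont_mull.
by exists S => // x; have := Sf (a * x)%g; rewrite /avg;
  under eq_bigr do rewrite -mulgA.
Qed.

Lemma mean_avg S f : S != [::] -> ucont f -> mean (avg S f) = mean f.
Proof.
move=> S0 uf; apply: mean_uniql => [|e /(lavg_mean uf)[T T0 Tf]].
  exact: ucont_avg.
by exists T => // x; rewrite -avg_lavgC; apply: avg_dist.
Qed.

(** Families are composed one function at a time: a further averaging preserves the estimates
    already obtained ([avg_dist]) and leaves the means unchanged ([mean_avg]). *)
Lemma avg_mean_seq (I : eqType) (r : seq I) (F : I -> G -> R) :
  (forall i, ucont (F i)) -> forall e, 0 < e ->
  exists2 S, S != [::] &
    forall i, i \in r -> forall x, `|avg S (F i) x - mean (F i)| <= e.
Proof.
move=> uF e e0; elim: r => [|i r [S S0 Sr]]; first by exists [:: 1%g].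
have [T T0 Ti] := avg_mean tbN (ucont_avg tbN S (uF i)) e0.
exists [seq (t * s)%g | t <- T, s <- S]; first exact: avg_allpairs_neq0.
move=> j; rewrite inE => /predU1P[->|jr] x; rewrite -avg_comp.
  by have := Ti x; rewrite mean_avg.
by apply: avg_dist => //; exact: Sr.
Qed.

Lemma meanD f g : ucont f -> ucont g ->
  mean (fun x => f x + g x) = mean f + mean g.
Proof.
move=> uf ug; apply: mean_uniqr => [|e e0]; first exact: ucontD.
have e2 : 0 < e / 2 by lra.
have [|S S0 Sfg] := @avg_mean_seq bool [:: true; false]
  (fun b => if b then f else g) _ _ e2; first by case.
exists S => // x; rewrite avgD.
have := Sfg true isT x; have := Sfg false isT x.
rewrite !ler_norml => /andP[? ?] /andP[? ?]; apply/andP; split; lra.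
Qed.

Lemma meanZ c f : ucont f -> mean (fun x => c * f x) = c * mean f.
Proof.
move=> uf; apply: mean_uniqr => [|e e0]; first exact: ucontZ.
have c0 : 0 < `|c| + 1 by rewrite ltr_wpDl.
have [|S S0 Sf] := avg_mean tbN uf (e := e / (`|c| + 1));
  first by rewrite divr_gt0.
exists S => // x; rewrite avgZ -mulrBr normrM.
rewrite (@le_trans _ _ ((`|c| + 1) * (e / (`|c| + 1))))//.
  by apply: ler_pM => //; rewrite lerDl.
by rewrite mulrCA divff ?mulr1// gt_eqF.
Qed.

Lemma meanN f : ucont f -> mean (fun x => - f x) = - mean f.
Proof.
move=> uf; rewrite -mulN1r -meanZ//; congr mean.
by apply/funext => x; rewrite mulN1r.
Qed.

Lemma meanB f g : ucont f -> ucont g ->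
  mean (fun x => f x - g x) = mean f - mean g.
Proof. by move=> uf ug; rewrite -meanN// -meanD//; exact: ucontN. Qed.

Lemma mean_sum I (r : seq I) (F : I -> G -> R) : (forall i, ucont (F i)) ->
  mean (fun x => \sum_(i <- r) F i x) = \sum_(i <- r) mean (F i).
Proof.
move=> uF; elim: r => [|i r IH].
  rewrite big_nil -[RHS](mean_cst 0); congr mean.
  by apply/funext => x; rewrite big_nil.
rewrite big_cons -IH -meanD//; last exact: ucont_sum.
by congr mean; apply/funext => x; rewrite big_cons.
Qed.

Lemma mean_ge0 f : ucont f -> (forall x, 0 <= f x) -> 0 <= mean f.
Proof.
move=> uf f0; apply/ler_addgt0Pl => e e0.
have [S S0 Sf] := avg_mean tbN uf e0; have := Sf 1%g.
have : 0 <= avg S f 1%g by rewrite -(avg_cst 0 1%g S0); exact: le_avg.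
by rewrite ler_norml => ? /andP[? ?]; lra.
Qed.

Lemma le_mean f g : ucont f -> ucont g -> (forall x, f x <= g x) ->
  mean f <= mean g.
Proof.
move=> uf ug fg; rewrite -subr_ge0 -meanB//; apply: mean_ge0.
  exact: ucontB.
by move=> x; rewrite subr_ge0.
Qed.

Lemma mean_dist f g e : ucont f -> ucont g -> (forall x, `|f x - g x| <= e) ->
  `|mean f - mean g| <= e.
Proof.
move=> uf ug fg; rewrite -meanB// ler_norml; apply/andP; split.
  rewrite -[leLHS]mean_cst; apply: le_mean => [||x].
  - exact: ucont_cst.
  - exact: ucontB.
  - by have := fg x; rewrite ler_norml => /andP[].
rewrite -[leRHS]mean_cst; apply: le_mean => [||x].
- exact: ucontB.
- exact: ucont_cst.
- by have := fg x; rewrite ler_norml => /andP[].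
Qed.

(** Averaging over a finite cover [F] for the modulus f(1) / 2 gives a function bounded below by
    f(1) / (2 |F|): for each x some x s is close enough to 1. This makes [dot] definite. *)
Lemma mean_gt0 f : ucont f -> (forall x, 0 <= f x) -> 0 < f 1%g -> 0 < mean f.
Proof.
move=> uf f0 f1; have e2 : 0 < f 1%g / 2 by lra.
have [V NV fV] := uf _ e2; have [F FV] := tbf_cover tbN NV.
have F0 : F != [::] by case: F FV => // /(_ 1%g)[].
rewrite -(mean_avg F0 uf).
apply: (@lt_le_trans _ _ ((size F)%:R^-1 * (f 1%g / 2))).
  by rewrite mulr_gt0// invr_gt0 size_gt0.
rewrite -[leLHS]mean_cst; apply: le_mean => [||x].
- exact: ucont_cst.
- exact: ucont_avg.
rewrite ler_wpM2l ?invr_ge0//; have [s sF Vs] := FV x^-1%g.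
rewrite (big_rem s)//=.
have : 0 <= \sum_(y <- rem s F) f (x * y)%g by apply: sumr_ge0.
have := fV (x * s)%g _ 1%g Vs.
by rewrite !mulg1 -!mulgA mulVKg mulgV ler_norml => /andP[]; lra.
Qed.

(** A single finite average in y replaces the mean over y, simultaneously for the sections [H x],
    uniformly in x through a finite cover, and for the function y -> mean of H over x. The exchange
    is then linearity of the mean over x. *)
Lemma mean_fubini (H : G -> G -> R) :
  (forall e, 0 < e -> exists2 V, N V &
     forall x v y z, V v -> `|H (x * v * y)%g z - H (x * y)%g z| <= e) ->
  (forall e, 0 < e -> exists2 V, N V &
     forall x v y z, V v -> `|H z (x * v * y)%g - H z (x * y)%g| <= e) ->
  mean (fun x => mean (fun y => H x y)) = mean (fun y => mean (fun x => H x y)).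
Proof.
move=> H1 H2.
have u1 y : ucont (H^~ y) by move=> e /H1[V NV HV]; exists V => // *; exact: HV.
have u2 x : ucont (H x) by move=> e /H2[V NV HV]; exists V => // *; exact: HV.
have uP : ucont (fun x => mean (fun y => H x y)).
  move=> e /H1[V NV HV]; exists V => // x v y Vv; apply: mean_dist => // z.
  exact: HV.
have uQ : ucont (fun y => mean (fun x => H x y)).
  move=> e /H2[V NV HV]; exists V => // x v y Vv; apply: mean_dist => // z.
  exact: HV.
apply: eqr_dist_le => e e0; have e4 : 0 < e / 4 by lra.
have [V NV HV] := H1 _ e4; have [F FV] := tbf_cover tbN NV.
(* [Some s] stands for the section at a point of the cover, [None] for the function of partial
   means. *)
have [|S S0 SF] := @avg_mean_seq (option G) (None :: map some F)
    (fun o => if o is Some s then H s else fun y => mean (fun x =>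
      H x y)) _ _ e4.
  by case.
have ravg : ucont (fun x => avg S (H x) 1%g).
  by apply: ucontZ => //; apply: ucont_sum => // s; exact: u1.
have : `|mean (fun x => mean (fun y => H x y)) - mean (fun x =>
  avg S (H x) 1%g)|
    <= e / 4 + e / 4 + e / 4.
  apply: mean_dist => // x; have [s sF Vs] := FV x.
  have sS : Some s \in None :: map some F by rewrite inE map_f.
  have d1 : `|mean (H x) - mean (H s)| <= e / 4.
    apply: mean_dist => // z; have := HV s _ 1%g z Vs.
    by rewrite !mulg1 mulVKg.
  have d2 : `|avg S (H x) 1%g - avg S (H s) 1%g| <= e / 4.
    rewrite /avg -mulrBr -sumrB normrM ger0_norm ?invr_ge0// mulrC.
    rewrite ler_pdivrMr ?size_gt0// (le_trans (ler_norm_sum _ _ _))//.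
    rewrite mulr_natr -sumr_const_seq; apply: ler_sum => t _.
    by have := HV s _ 1%g (1 * t)%g Vs; rewrite !mulg1 mulVKg.
  have := SF _ sS 1%g; move: d1 d2.
  rewrite !ler_norml => /andP[? ?] /andP[? ?] /andP[? ?]; apply/andP; split;
    lra.
have -> : mean (fun x => avg S (H x) 1%g) =
    avg S (fun y => mean (fun x => H x y)) 1%g.
  rewrite /avg meanZ; first by rewrite mean_sum.
  by apply: ucont_sum.
have := SF None isT 1%g => /=.
rewrite !ler_norml => /andP[? ?] /andP[? ?]; apply/andP; split; lra.
Qed.

End Mean.

(** * A bump function at the identity *)

Section TbUniformity.
Variables (R : realType) (G : groupType) (N : set (set G)).
Hypothesis tbN : tb_filter N.

(** An alias of G to carry its left uniformity; the proof is an argument so that the instance can be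
    built from it. *)
Definition tb_uniform (_ : tb_filter N) : Type := G.
Local Notation T := (tb_uniform tbN).

Let filtN : Filter N := tbf_filter tbN.
#[local] Existing Instance filtN.

Definition tb_entourage : set_system (T * T) := [set A |
  exists2 V, N V & forall x y : G, V (x^-1 * y)%g -> A (x, y)].

Lemma tb_entourage_filter : Filter tb_entourage.
Proof.
split.
- by exists setT => //; exact: filterT.
- move=> A B [V NV VA] [W NW WB]; exists (V `&` W); first exact: filterI.
  by move=> x y [Vxy Wxy]; split; [exact: VA|exact: WB].
- by move=> A B AB [V NV VA]; exists V => // x y /VA/AB.
Qed.

Lemma tb_entourage_refl A : tb_entourage A -> diagonal `<=` A.
Proof.
move=> [V NV VA] [x y] /diagonalP/= ->; apply: VA.
by rewrite mulVg; exact: tbf_one NV.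
Qed.

Lemma tb_entourage_inv A : tb_entourage A -> tb_entourage A^-1%relation.
Proof.
move=> [V NV VA]; exists [set x | V x^-1%g]; first exact: tbf_inv NV.
by move=> x y /=; rewrite invgM invgK; exact: VA.
Qed.

Lemma tb_entourage_split A : tb_entourage A ->
  exists2 B, tb_entourage B & (B \; B)%relation `<=` A.
Proof.
move=> [V NV VA]; have [W NW WV] := tbf_mul tbN NV.
exists [set xy : T * T | W ((xy.1 : G)^-1 * xy.2)%g].
  by exists W.
move=> [x z] [y /= Wxy Wyz]; apply: VA.
by have := WV _ _ Wxy Wyz; rewrite mulgA -(mulgA x^-1%g) mulgV mulg1.
Qed.

HB.instance Definition _ := Choice.on T.
HB.instance Definition _ := @isUniform.Build T tb_entourage
  tb_entourage_filter tb_entourage_refl tb_entourage_inv tb_entourage_split.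

(** The gauge pseudometric of the entourage defined by U gives a distance d to 1. Truncating r0 - d
    at 0 confines the support to a ball, and the product with the reflected function is symmetric.
    The gauge only controls the left uniformity; [tbf_conj] upgrades this to [ucont]. *)
Lemma ucont_bump (U : set G) : N U ->
  exists k : G -> R, [/\ ucont N k, forall x, 0 <= k x, 0 < k 1%g,
    forall x, k x^-1%g = k x & forall x, k x != 0 -> U x].
Proof.
move=> NU; pose E : set (T * T) := [set xy | U ((xy.1 : G)^-1 * xy.2)%g].
have entE : entourage E by exists U.
pose T' : pseudoMetricType R := gauge.type entE.
have : @entourage T' E by exists 0%N => //; move=> ? [].
rewrite -entourage_ballE => -[r0 /= r00 ballE].
pose d (x : T') : R := fine (edist (x, 1%g : T')).
(* Any two points lie in a common ball of radius 2, so the extended distance is finite and [fine] is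
   faithful. *)
have dfin (x y : T') : @edist R T' (x, y) \is a fin_num.
  by apply/edist_finP; exists 2 => //;
    exact: countable_uniform.countable_uniform_bounded.
have d0 x : 0 <= d x by rewrite fine_ge0// edist_ge0.
have d1 : d (1%g : G) = 0 by rewrite /d edist_refl.
have dlip (x y : T') r : 0 < r -> ball x r y -> d x <= r + d y.
  move=> r0' xy; rewrite -lee_fin EFinD !fineK//.
  by rewrite (le_trans (edist_triangle _ y _))// leeD2r// edist_fin.
have ud : ucont N d.
  move=> e e0.
  have entB : @entourage T' [set xy | ball (xy.1 : T') e xy.2].
    by rewrite -entourage_ballE; exists e.
  have [V NV Ve] : @entourage T _ := gauge.gauge_ent entE entB.
  have [W NW WV] := tbf_conj tbN NV.
  exists [set x | W x^-1%g]; first exact: tbf_inv tbN _ NW.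
  move=> x w y Wiw.
  have ball1 : ball ((x * w * y)%g : T') e ((x * y)%g : T').
    apply: Ve; have := WV y^-1%g _ Wiw.
    by rewrite invgK !invgM -!mulgA mulKg.
  have ball2 : ball ((x * y)%g : T') e ((x * w * y)%g : T').
    exact: ball_sym.
  have := dlip _ _ _ e0 ball1; have := dlip _ _ _ e0 ball2.
  by rewrite ler_distl => ? ?; apply/andP; split; lra.
pose k x := Num.max 0 (r0 - d x).
have kE x : 0 < k x -> U (x^-1)%g.
  rewrite /k lt_max ltxx/= subr_gt0 => dr; have := ballE (x, 1%g : G).
  rewrite /E/= mulg1; apply; apply: (@edist_lt_ball R T' r0 (x, 1%g : G)).
  by rewrite -[X in (X < _)%E]fineK ?lte_fin.
have k0 x : 0 <= k x by rewrite le_max lexx.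
exists (fun x => k x * k x^-1%g); split.
- have uk : ucont N k by apply: ucont_max0; apply: ucontB => //;
  exact: ucont_cst.
  by apply: ucontM => //; exact: ucont_inv.
- by move=> x; rewrite mulr_ge0.
- by rewrite invg1 /k d1 subr0 mulr_gt0// lt_max r00 orbT.
- by move=> x; rewrite invgK mulrC.
- move=> x; rewrite mulf_eq0 negb_or => /andP[_ kx].
  by rewrite -(invgK x); apply: kE; rewrite lt0r kx k0.
Qed.
End TbUniformity.

(** * Convolution operators *)

Section Convolution.
Variables (R : realType) (G : groupType) (N : set (set G)).
Hypothesis tbN : tb_filter N.
Implicit Types (f g h p : G -> R).

Let filtN : Filter N := tbf_filter tbN.
#[local] Existing Instance filtN.
Local Notation ucont := (ucont N).

Lemma ler_norm_sqr (a e : R) : 0 <= e -> (`|a| <= e) = (a ^+ 2 <= e ^+ 2).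
Proof. by move=> e0; rewrite -[a ^+ 2]real_normK ?num_real// ler_sqr ?nnegrE.
  Qed.

Definition dot f g : R := mean (fun x => f x * g x).

Lemma dotC f g : dot f g = dot g f.
Proof. by congr mean; apply/funext => x; rewrite mulrC. Qed.

Lemma dotZl c f h : ucont f -> ucont h -> dot (fun x =>
  c * f x) h = c * dot f h.
Proof.
move=> uf uh; rewrite /dot -(meanZ tbN); do ?exact: ucontM.
by congr mean; apply/funext => x; rewrite mulrA.
Qed.

Lemma dotBl f g h : ucont f -> ucont g -> ucont h ->
  dot (fun x => f x - g x) h = dot f h - dot g h.
Proof.
move=> uf ug uh; rewrite /dot -(meanB tbN); do ?exact: ucontM.
by congr mean; apply/funext => x; rewrite mulrBl.
Qed.

Lemma dotBr f g h : ucont f -> ucont g -> ucont h ->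
  dot h (fun x => f x - g x) = dot h f - dot h g.
Proof. by move=> *; rewrite dotC dotBl// !(dotC h). Qed.

Lemma dotZr c f h : ucont f -> ucont h -> dot h (fun x =>
  c * f x) = c * dot h f.
Proof. by move=> *; rewrite dotC dotZl// (dotC h). Qed.

Lemma dot_suml I (r : seq I) (F : I -> G -> R) h : (forall i, ucont (F i)) ->
  ucont h -> dot (fun x => \sum_(i <- r) F i x) h = \sum_(i <- r) dot (F i) h.
Proof.
move=> uF uh; rewrite /dot -(mean_sum tbN); last by move=> i; exact: ucontM.
by congr mean; apply/funext => x; rewrite mulr_suml.
Qed.

Lemma dot_sumr I (r : seq I) (F : I -> G -> R) h : (forall i, ucont (F i)) ->
  ucont h -> dot h (fun x => \sum_(i <- r) F i x) = \sum_(i <- r) dot h (F i).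
Proof.
by move=> uF uh; rewrite dotC dot_suml//; apply: eq_bigr => i _; rewrite dotC.
Qed.

Lemma dot_ge0 f : ucont f -> 0 <= dot f f.
Proof.
by move=> uf; apply: (mean_ge0 tbN) => [|x];
  [exact: ucontM|rewrite -expr2 sqr_ge0].
Qed.

Lemma dot_eq0 f : ucont f -> dot f f = 0 -> forall x, f x = 0.
Proof.
move=> uf f0 x; apply/eqP; apply/negPn/negP => fx.
have uff : ucont (fun x => f x * f x) by exact: ucontM.
suff : 0 < dot f f by rewrite f0 ltxx.
rewrite /dot -(mean_mull tbN x uff); apply: (mean_gt0 tbN).
- exact: ucont_mull uff.
- by move=> y; rewrite -expr2 sqr_ge0.
- by rewrite mulg1 -expr2 exprn_even_gt0.
Qed.

Lemma dot_translate f g b : ucont f -> ucont g ->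
  dot (fun x => f (x * b)%g) (fun x => g (x * b)%g) = dot f g.
Proof.
by move=> uf ug; exact: (mean_mulr tbN b (ucontM tbN uf ug)).
Qed.

(** Pythagoras. It yields Cauchy-Schwarz, and later the near-orthogonality of minimizing residuals
    to trigonometric polynomials. *)
Lemma dot_residual f g : ucont f -> ucont g -> dot g g != 0 ->
  dot (fun x => f x - dot f g / dot g g * g x)
      (fun x => f x - dot f g / dot g g * g x) =
  dot f f - dot f g ^+ 2 / dot g g.
Proof.
move=> uf ug g0; set c := dot f g / dot g g.
have ucg : ucont (fun x => c * g x) by exact: ucontZ.
have ud : ucont (fun x => f x - c * g x) by exact: ucontB.
rewrite dotBl// !dotBr// !dotZl// !dotZr// (dotC g f) ?dotZl//.
by rewrite /c; field.
Qed.

Lemma cauchy_schwarz f g : ucont f -> ucont g -> dot f g ^+ 2 <= dot f f * dot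
  g g.
Proof.
move=> uf ug; have [g0|g0] := eqVneq (dot g g) 0.
  rewrite (_ : dot f g = 0) ?g0 ?mulr0 ?expr0n//.
  rewrite -(mean_cst tbN (0 : R)); congr mean; apply/funext => x.
  by rewrite (dot_eq0 ug g0) mulr0.
have gp : 0 < dot g g by rewrite lt0r g0 dot_ge0.
have := dot_ge0 (ucontB tbN uf (ucontZ tbN (dot f g / dot g g) ug)).
by rewrite dot_residual// subr_ge0 ler_pdivrMr.
Qed.

Lemma bessel m (e : 'I_m -> G -> R) h : (forall i, ucont (e i)) ->
  (forall i j, dot (e i) (e j) = (i == j)%:R) -> ucont h ->
  dot (fun x => h x - \sum_i dot h (e i) * e i x)
      (fun x => h x - \sum_i dot h (e i) * e i x) =
  dot h h - \sum_i dot h (e i) ^+ 2.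
Proof.
move=> ue oe uh; set s := fun x => \sum_i dot h (e i) * e i x.
have uci i : ucont (fun x => dot h (e i) * e i x) by exact: ucontZ.
have us : ucont s by exact: ucont_sum.
have hs : dot h s = \sum_i dot h (e i) ^+ 2.
  by rewrite dot_sumr//; apply: eq_bigr => i _; rewrite dotZr// expr2.
have ss : dot s s = \sum_i dot h (e i) ^+ 2.
  rewrite dot_suml//; apply: eq_bigr => i _; rewrite dotZl// expr2;
    congr (_ * _).
  rewrite dot_sumr// (bigD1 i)//= dotZr// oe eqxx mulr1 big1 ?addr0// => j ji.
  by rewrite dotZr// oe eq_sym (negPf ji) mulr0.
have ud : ucont (fun x => h x - s x) by exact: ucontB.
by rewrite (dotBl (h := fun x => h x - s x))// !dotBr// (dotC s) hs ss; ring.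
Qed.

Variable k : G -> R.
Hypotheses (uk : ucont k) (symk : forall x, k x^-1%g = k x).

Definition conv f (x : G) : R := mean (fun y => k (x * y^-1)%g * f y).

Lemma ucont_kernel x : ucont (fun y => k (x * y^-1)%g).
Proof. exact: (ucont_inv tbN (ucont_mull x uk)). Qed.

Lemma dot_kernel x :
  dot (fun y => k (x * y^-1)%g) (fun y => k (x * y^-1)%g) = dot k k.
Proof.
have ukk := ucontM tbN uk uk; rewrite /dot -(mean_mull tbN x ukk).
by rewrite -(mean_inv tbN (ucont_mull x ukk)).
Qed.

Lemma conv_sqr_le f x : ucont f -> conv f x ^+ 2 <= dot k k * dot f f.
Proof. by move=> uf; rewrite -(dot_kernel x); apply: cauchy_schwarz => //;
  exact: ucont_kernel. Qed.

(** By Cauchy-Schwarz an increment of [conv f] is at most the L2 distance of two translated kernels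
    times the L2 norm of f, so V depends on k and the bound C only. This is the source of all
    compactness below. *)
Lemma conv_equicont C : 0 <= C -> forall e, 0 < e -> exists2 V, N V &
  forall f, ucont f -> dot f f <= C -> forall x v y, V v ->
    `|conv f (x * v * y)%g - conv f (x * y)%g| <= e.
Proof.
move=> C0 e e0; have e1 : 0 < e / (C + 1) by rewrite divr_gt0//; lra.
have [V NV kV] := uk e1; exists V => // f uf fC x v y Vv.
have uk1 := ucont_kernel (x * v * y)%g; have uk2 := ucont_kernel (x * y)%g.
have -> : conv f (x * v * y)%g - conv f (x * y)%g =
  dot (fun z => k (x * v * y * z^-1)%g - k (x * y * z^-1)%g) f by rewrite dotBl.
rewrite ler_norm_sqr ?(ltW e0)//.
apply: (le_trans (cauchy_schwarz (ucontB tbN uk1 uk2) uf)).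
have : dot (fun z => k (x * v * y * z^-1)%g - k (x * y * z^-1)%g)
    (fun z => k (x * v * y * z^-1)%g - k (x * y * z^-1)%g) <= (e / (C + 1)) ^+
      2.
  rewrite -[leRHS](mean_cst tbN); apply: (le_mean tbN) => [||z].
  - by apply: ucontM => //; exact: ucontB.
  - exact: ucont_cst.
  - have := kV x v (y * z^-1)%g Vv; rewrite !mulgA => kz.
    by rewrite -expr2 -ler_norm_sqr// ltW.
move=> kz; apply: (@le_trans _ _ ((e / (C + 1)) ^+ 2 * C)).
  by apply: ler_pM => //; apply: dot_ge0 => //; exact: ucontB.
have -> : (e / (C + 1)) ^+ 2 * C = e ^+ 2 * (C / (C + 1) ^+ 2).
  by field; lra.
rewrite ler_piMr ?sqr_ge0// ler_pdivrMr ?exprn_gt0//; nra.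
Qed.

Lemma ucont_conv f : ucont f -> ucont (conv f).
Proof.
move=> uf e e0; have [V NV H] := conv_equicont (dot_ge0 uf) e0.
by exists V => // x v y Vv; exact: H.
Qed.

Lemma convB f g x : ucont f -> ucont g ->
  conv (fun y => f y - g y) x = conv f x - conv g x.
Proof. by move=> uf ug; rewrite /conv -/(dot _ _) dotBr//;
  exact: ucont_kernel. Qed.

Lemma convZ c f x : ucont f -> conv (fun y => c * f y) x = c * conv f x.
Proof. by move=> uf; rewrite /conv -/(dot _ _) dotZr//;
  exact: ucont_kernel. Qed.

Lemma conv_sum I (r : seq I) (F : I -> G -> R) x : (forall i, ucont (F i)) ->
  conv (fun y => \sum_(i <- r) F i y) x = \sum_(i <- r) conv (F i) x.
Proof. by move=> uF; rewrite /conv -/(dot _ _) dot_sumr//;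
  exact: ucont_kernel. Qed.

Lemma conv_mulr f b x : ucont f -> conv (fun y =>
  f (y * b)%g) x = conv f (x * b)%g.
Proof.
move=> uf; rewrite /conv -(mean_mulr tbN b (ucontM tbN (ucont_kernel (x * b)%g)
  uf)).
by congr mean; apply/funext => y; rewrite invgM !mulgA mulgK.
Qed.

(** Fubini and the symmetry of k. Most of the proof checks that k(x y^-1) f(y) g(x) is
    equicontinuous in each variable uniformly in the other. *)
Lemma conv_dot f g : ucont f -> ucont g -> dot (conv f) g = dot f (conv g).
Proof.
move=> uf ug; have [B B0 kB] := ucont_bounded tbN uk.
have [C C0 fC] := ucont_bounded tbN uf; have [D D0 gD] := ucont_bounded tbN ug.
have -> : dot (conv f) g = mean (fun x => mean (fun y =>
  k (x * y^-1)%g * f y * g x)).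
  congr mean; apply/funext => x; rewrite mulrC /conv -(meanZ tbN).
    by congr mean; apply/funext => y; rewrite mulrC.
  by apply: ucontM => //; exact: ucont_kernel.
rewrite (mean_fubini tbN); last 2 first.
- move=> e e0; have e1 : 0 < e / (2 * C * D) by rewrite divr_gt0// !mulr_gt0.
  have e2 : 0 < e / (2 * C * B) by rewrite divr_gt0// !mulr_gt0.
  have [V NV kV] := uk e1; have [W NW gW] := ug _ e2.
  exists (V `&` W); first exact: filterI.
  move=> x v y z [Vv Wv]; have := kV x v (y * z^-1)%g Vv; rewrite !mulgA.
  have := gW x v y Wv; have := fC z; have := gD (x * v * y)%g.
  have := kB (x * y * z^-1)%g.
  set a := k _; set a' := k _; set b := g _; set b' := g _; set c := f _.
  move=> aB bD cC bb' aa'.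
  have -> : a' * c * b - a * c * b' = (a' - a) * (c * b) + a * (c * (b - b'))
    by ring.
  apply: (le_trans (ler_normD _ _)); rewrite !normrM.
  have -> : e = e / (2 * C * D) * (C * D) + B * (C * (e / (2 * C * B))).
    by field; rewrite !gt_eqF.
  by apply: lerD; apply: ler_pM => //; rewrite ?mulr_ge0//; apply: ler_pM.
- move=> e e0; have e1 : 0 < e / (2 * C * D) by rewrite divr_gt0// !mulr_gt0.
  have e2 : 0 < e / (2 * D * B) by rewrite divr_gt0// !mulr_gt0.
  have [V NV kV] := ucont_inv tbN uk e1; have [W NW fW] := uf _ e2.
  exists (V `&` W); first exact: filterI.
  move=> x v y z [Vv Wv]; have := kV x v (y * z^-1)%g Vv.
  rewrite (_ : (x * v * (y * z^-1))^-1 = z * (x * v * y)^-1)%g; last first.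
    by rewrite !invgM invgK !mulgA.
  rewrite (_ : (x * (y * z^-1))^-1 = z * (x * y)^-1)%g; last first.
    by rewrite !invgM invgK !mulgA.
  have := fW x v y Wv; have := gD z; have := fC (x * v * y)%g.
  have := kB (z * (x * y)^-1)%g.
  set a := k _; set a' := k _; set b := f _; set b' := f _; set c := g _.
  move=> aB bD cC bb' aa'.
  have -> : a' * b * c - a * b' * c = (a' - a) * (b * c) + a * (c * (b - b'))
    by ring.
  apply: (le_trans (ler_normD _ _)); rewrite !normrM.
  have -> : e = e / (2 * C * D) * (C * D) + B * (D * (e / (2 * D * B))).
    by field; rewrite !gt_eqF.
  by apply: lerD; apply: ler_pM => //; rewrite ?mulr_ge0//; apply: ler_pM.
congr mean; apply/funext => y; rewrite /conv -(meanZ tbN).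
  congr mean; apply/funext => x; rewrite -symk invgM invgK.
  by rewrite mulrAC mulrC.
by apply: ucontM => //; exact: ucont_kernel.
Qed.

Lemma conv_dist f g e B : ucont f -> ucont g -> (forall x, `|k x| <= B) ->
  (forall x, `|f x - g x| <= e) -> forall x, `|conv f x - conv g x| <= B * e.
Proof.
move=> uf ug kB fg x; apply: (mean_dist tbN).
- by apply: ucontM => //; exact: ucont_kernel.
- by apply: ucontM => //; exact: ucont_kernel.
by move=> y; rewrite -mulrBr normrM; apply: ler_pM.
Qed.

(** Arzela-Ascoli along an ultrafilter finer than the eventual filter: bounded real sequences
    converge along it, so pointwise limits exist at all x at once, without extracting a diagonal
    sequence. Equicontinuity and a finite cover make the convergence uniform. *)
Lemma conv_precompact C (F : nat -> G -> R) :
  (forall n, ucont (F n)) -> (forall n, dot (F n) (F n) <= C) ->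
  exists2 g, ucont g & forall e n0, 0 < e ->
    exists2 n, (n0 <= n)%N & forall x, `|conv (F n) x - g x| <= e.
Proof.
move=> uF FC; have C0 : 0 <= C by rewrite (le_trans (dot_ge0 (uF 0%N))).
have [U [ultU ooU]] := ultraFilterLemma (@eventually_filter).
(* The added 1 gives B <= B ^ 2, so a bound on the square of [conv (F n)] becomes a bound by B
   without a square root. *)
pose B := dot k k * C + 1.
have B1 : 1 <= B by rewrite /B lerDr mulr_ge0// dot_ge0.
have convB n x : `|conv (F n) x| <= B.
  rewrite ler_norm_sqr ?(le_trans (conv_sqr_le x (uF n)))//; last by lra.
  have : dot k k * dot (F n) (F n) <= dot k k * C by rewrite ler_wpM2l//
    dot_ge0.
  by rewrite /B => ?; nra.
have /choice[g gP] x : exists l : R, (fun n => conv (F n) x) @ U --> l.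
  have [|l [_ Ul]] := @segment_compact R (- B) B ((fun n => conv (F n) x) @ U).
    have UB : U [set n | `|conv (F n) x| <= B] by apply: filterS filterT =>
      n _; exact: convB.
    suff : U ((fun n => conv (F n) x) @^-1` `[- B, B]) by [].
    by apply: filterS UB => n /=; rewrite in_itv/= -ler_norml.
  exists l => A Al; have [//|UA] := in_ultra_setVsetC ((fun n =>
    conv (F n) x) @^-1` A) ultU.
  by have [y [/= nAy Ay]] := Ul (~` A) A UA Al.
have gU x e : 0 < e -> U [set n | `|conv (F n) x - g x| <= e].
  move=> e0; have /cvgrPdist_le/(_ e e0) := gP x; apply: filterS => n /=.
  by rewrite distrC.
(* Five errors of e / 5: from x to a cover point s at index n, from n to the limit at s, then back
   to the limit at x through an auxiliary index m that may depend on x. *)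
have unif e : 0 < e -> U [set n | forall x, `|conv (F n) x - g x| <= e].
  move=> e0; have e5 : 0 < e / 5 by lra.
  have [V NV VF] := conv_equicont C0 e5; have [S SV] := tbf_cover tbN NV.
  have : U [set n | forall s, s \in S -> `|conv (F n) s - g s| <= e / 5].
    elim: S {SV} => [|s S IH]; first by apply: filterS filterT => n _ s.
    apply: filterS2 (gU s _ e5) IH => n ns nS t.
    by rewrite inE => /predU1P[->|/nS].
  apply: filterS => n nS x; have [s sS Vs] := SV x.
  have [m []] := filter_ex (filterI (gU s _ e5) (gU x _ e5)).
  have := VF _ (uF m) (FC m) s _ 1%g Vs; have := VF _ (uF n) (FC n) s _ 1%g Vs.
  have := nS _ sS; rewrite !mulg1 mulVKg !ler_norml /=.
  rewrite !ler_norml => /andP[? ?] /andP[? ?] /andP[? ?] /andP[? ?] /andP[? ?].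
  by apply/andP; split; lra.
exists g.
  apply: ucont_lim => e /unif/filter_ex[n nP].
  by exists (conv (F n)) => [|x]; [exact: ucont_conv|rewrite distrC].
move=> e n0 e0; have : U [set n | (n0 <= n)%N] by apply: ooU;
  exact: nbhs_infty_ge.
by move=> /(filterI (unif _ e0))/filter_ex[n [? ?]]; exists n.
Qed.
End Convolution.

(** * The Peter-Weyl theorem *)

Section PeterWeyl.
Variables (R : realType) (G : groupType) (N : set (set G)).
Hypothesis tbN : tb_filter N.
Implicit Types (f g h p : G -> R).

Let filtN : Filter N := tbf_filter tbN.
#[local] Existing Instance filtN.
Local Notation ucont := (ucont N).

Definition orth_rep n (phi : G -> 'M[R]_n) : Prop :=
  [/\ forall x, phi x *m (phi x)^T = 1%:M,
      {morph phi : x y / (x * y)%g >-> x *m y}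
    & forall i j, ucont (fun x => phi x i j)].

Lemma orth_rep1 n (phi : G -> 'M[R]_n) : orth_rep phi -> phi 1%g = 1%:M.
Proof.
move=> [phiT phiM _]; have := congr1 (mulmx^~ (phi 1%g)^T) (phiM 1%g 1%g).
by rewrite mulg1 -mulmxA phiT mulmx1.
Qed.

Lemma orth_repV n (phi : G -> 'M[R]_n) x : orth_rep phi ->
  phi x^-1%g = (phi x)^T.
Proof.
move=> phir; have [phiT phiM _] := phir.
by rewrite -[RHS]mul1mx -(orth_rep1 phir) -(mulVg x) phiM -mulmxA phiT mulmx1.
Qed.

(** Trigonometric polynomials: the trace against A is an arbitrary linear combination of the
    coefficients of one representation. *)
Definition trig p := exists n (phi : G -> 'M[R]_n) (A : 'M[R]_n),
  orth_rep phi /\ forall x, p x = \tr (A *m phi x).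

Lemma mxtrace_mulE n (A B : 'M[R]_n) : \tr (A *m B) = \sum_i \sum_j A i j * B j
  i.
Proof. by apply: eq_bigr => i _; rewrite mxE. Qed.

Lemma trig_ucont p : trig p -> ucont p.
Proof.
move=> [n [phi [A [[_ _ uphi] pE]]]].
rewrite (_ : p = fun x => \sum_i \sum_j A i j * phi x j i).
  by apply: ucont_sum => // i; apply: ucont_sum => // j; exact: ucontZ.
by apply/funext => x; rewrite pE mxtrace_mulE.
Qed.

Lemma trig_lin c p q : trig p -> trig q -> trig (fun x => c * p x + q x).
Proof.
move=> [n [phi [A [[phiT phiM uphi] pE]]]] [m [psi [B [[psiT psiM upsi] qE]]]].
exists (n + m)%N, (fun x =>
  block_mx (phi x) 0 0 (psi x)), (block_mx (c *: A) 0 0 B).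
split; first split.
- move=> x; rewrite tr_block_mx !trmx0 mulmx_block !mulmx0 !mul0mx !addr0
  !add0r.
  by rewrite phiT psiT -scalar_mx_block.
- move=> x y; rewrite mulmx_block !mulmx0 !mul0mx !addr0 !add0r.
  by rewrite phiM psiM.
- move=> i j; case: (splitP i) => i' ii'; case: (splitP j) => j' jj'.
  + have -> : i = lshift m i' by apply: val_inj.
    have -> : j = lshift m j' by apply: val_inj.
    by under eq_fun do rewrite block_mxEul; exact: uphi.
  + have -> : i = lshift m i' by apply: val_inj.
    have -> : j = rshift n j' by apply: val_inj.
    by under eq_fun do rewrite block_mxEur mxE; exact: ucont_cst.
  + have -> : i = rshift n i' by apply: val_inj.
    have -> : j = lshift m j' by apply: val_inj.
    by under eq_fun do rewrite block_mxEdl mxE; exact: ucont_cst.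
  + have -> : i = rshift n i' by apply: val_inj.
    have -> : j = rshift n j' by apply: val_inj.
    by under eq_fun do rewrite block_mxEdr; exact: upsi.
move=> x; rewrite mulmx_block !mulmx0 !mul0mx !addr0 !add0r mxtrace_block.
by rewrite -scalemxAl mxtraceZ pE qE.
Qed.

Lemma trig0 : trig (fun=> 0).
Proof.
exists 0%N, (fun=> 1%:M), 0; split; last by move=> x; rewrite mul0mx mxtrace0.
split=> [x|x y|]; rewrite ?trmx1 ?mulmx1//.
by case.
Qed.

Variable k : G -> R.
Hypotheses (uk : ucont k) (symk : forall x, k x^-1%g = k x).
Local Notation T := (conv k).

Lemma trig_conv p : trig p -> trig (T p).
Proof.
move=> pt; have up := trig_ucont pt; move: pt => [n [phi [A [phir pE]]]].
have [phiT phiM uphi] := phir.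
exists n, phi, (A *m (\matrix_(i, j) mean (fun y => k y * phi y i j))^T).
split=> // x; pose F y := k (x * y^-1)%g * p y.
have uF : ucont F by apply: ucontM => //; exact: ucont_kernel.
(* The substitution y -> y^-1 x, allowed by invariance, turns the integrand into k(y) p(y^-1 x).
   There x occurs only in the factor [phi x], and the mean of k phi is absorbed in the coefficient
   matrix. *)
rewrite -[LHS]/(mean F) -(mean_inv tbN uF) -(mean_mull tbN x^-1%g (ucont_inv
  tbN uF)).
pose M := \matrix_(i, j) mean (fun y => k y * phi y i j).
have trE (Y : 'M[R]_n) : \tr (A *m Y^T *m phi x) = \sum_i \sum_j (phi x *m A) i
  j * Y i j.
  rewrite mxtrace_mulC mulmxA mxtrace_mulE; apply: eq_bigr => i _.
  by apply: eq_bigr => j _; rewrite [Y^T _ _]mxE.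
rewrite trE; transitivity
    (mean (fun y => \sum_i \sum_j (phi x *m A) i j * (k y * phi y i j))).
  congr mean; apply/funext => y.
  rewrite /F !invgM !invgK mulgA mulgV mul1g pE phiM (orth_repV _ phir) mulmxA
    trE.
  rewrite mulr_sumr; apply: eq_bigr => i _; rewrite mulr_sumr;
    apply: eq_bigr => j _.
  by rewrite mulrCA.
have ukphi i j : ucont (fun y => k y * phi y i j) by exact: ucontM.
rewrite (mean_sum tbN) => [|i]; last by apply: ucont_sum => // j; exact: ucontZ.
apply: eq_bigr => i _; rewrite (mean_sum tbN) => [|j]; last exact: ucontZ.
by apply: eq_bigr => j _; rewrite (meanZ tbN)// mxE.
Qed.

(** * Eigenspaces of the squared convolution operator *)

Section Eigenspace.
Variable L : R.
Hypothesis L0 : 0 < L.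

(** Eigenfunctions of the square of [T]: maximizing the norm of T h produces these directly, with L
    > 0 and no choice of sign. *)
Definition eigen f := ucont f /\ forall x, T (T f) x = L * f x.

Definition eigen_orthonormal m (e : 'I_m -> G -> R) :=
  (forall i, eigen (e i)) /\ forall i j, dot (e i) (e j) = (i == j)%:R.

Lemma eigenZ c f : eigen f -> eigen (fun x => c * f x).
Proof.
move=> [uf fL]; split=> [|x]; first exact: ucontZ.
rewrite (_ : T (fun x => c * f x) = fun x => c * T f x).
  by rewrite (convZ tbN)//; [rewrite fL mulrCA|exact: ucont_conv].
by apply/funext => y; rewrite (convZ tbN).
Qed.

Lemma eigenB f g : eigen f -> eigen g -> eigen (fun x => f x - g x).
Proof.
move=> [uf fL] [ug gL]; split=> [|x]; first exact: ucontB.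
rewrite (_ : T (fun x => f x - g x) = fun x => T f x - T g x).
  by rewrite (convB tbN)//;
    [rewrite fL gL mulrBr|exact: ucont_conv|exact: ucont_conv].
by apply/funext => y; rewrite (convB tbN).
Qed.

Lemma eigen_sum I (r : seq I) (F : I -> G -> R) : (forall i, eigen (F i)) ->
  eigen (fun x => \sum_(i <- r) F i x).
Proof.
move=> eF; split=> [|x]; first by apply: ucont_sum => // i; case: (eF i).
rewrite (_ : T (fun x => \sum_(i <- r) F i x) = fun x =>
  \sum_(i <- r) T (F i) x).
  rewrite (conv_sum tbN)//; last by move=> i; apply: ucont_conv => //;
    case: (eF i).
  by rewrite mulr_sumr; apply: eq_bigr => i _; case: (eF i).
by apply/funext => y; rewrite (conv_sum tbN)// => i; case: (eF i).
Qed.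

Lemma eigen_mulr f b : eigen f -> eigen (fun x => f (x * b)%g).
Proof.
move=> [uf fL]; split=> [|x]; first exact: ucont_mulr.
rewrite (_ : T (fun x => f (x * b)%g) = fun x => T f (x * b)%g).
  by rewrite (conv_mulr tbN)//; exact: ucont_conv.
by apply/funext => y; rewrite (conv_mulr tbN).
Qed.

(** A Hilbert-Schmidt estimate. With kx(y) = k(x y^-1), the coefficient of T kx on e i is T (T (e
    i)) x = L * e i x. Bessel's inequality bounds the sum of the squares by |T kx|^2 <= |k|^4;
    taking the mean over x gives the claim. *)
Lemma eigen_orthonormal_bound m (e : 'I_m -> G -> R) : eigen_orthonormal e ->
  m%:R * L ^+ 2 <= dot k k ^+ 2.
Proof.
move=> [eE eO]; have ue i : ucont (e i) by case: (eE i).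
have -> : m%:R * L ^+ 2 = mean (fun x => \sum_i L ^+ 2 * (e i x * e i x)).
  rewrite (mean_sum tbN); last by move=> i; apply: ucontZ => //; exact: ucontM.
  rewrite -[in LHS](card_ord m) mulr_natl -sumr_const; apply: eq_bigr => i _.
  rewrite (meanZ tbN); last exact: ucontM.
  by rewrite -[mean _]/(dot _ _) eO eqxx mulr1.
rewrite -[leRHS](mean_cst tbN); apply: (le_mean tbN) => [||x].
- by apply: ucont_sum => // i; apply: ucontZ => //; exact: ucontM.
- exact: ucont_cst.
have ukx := ucont_kernel tbN uk x; set kx := fun y => _ in ukx.
have uTkx : ucont (T kx) by exact: ucont_conv.
have uTe i : ucont (T (e i)) by exact: ucont_conv.
apply: (@le_trans _ _ (dot (T kx) (T kx))).
  have us : ucont (fun z => \sum_i dot (T kx) (e i) * e i z).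
    by apply: ucont_sum => // i; exact: ucontZ.
  have := dot_ge0 tbN (ucontB tbN uTkx us).
  rewrite (bessel tbN)// subr_ge0; apply: le_trans; rewrite le_eqVlt;
    apply/orP; left.
  apply/eqP; apply: eq_bigr => i _.
  rewrite (conv_dot tbN)// -[dot kx _]/(T _ x); case: (eE i) => _ ->.
  by rewrite exprMn expr2 -expr2.
rewrite -[leRHS](mean_cst tbN); apply: (le_mean tbN) => [||z].
- exact: ucontM.
- exact: ucont_cst.
by rewrite -expr2 (le_trans (conv_sqr_le tbN uk z ukx))// (dot_kernel tbN)//
  expr2.
Qed.

(** An orthonormal family of maximal size exists by the preceding bound; a nonzero residual of f,
    once normalized, would extend it. *)
Lemma eigen_basis : exists m (e : 'I_m -> G -> R), eigen_orthonormal e /\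
  forall f, eigen f -> forall x, f x = \sum_i dot f (e i) * e i x.
Proof.
pose P m := asbool (exists e : 'I_m -> G -> R, eigen_orthonormal e).
have P0 : exists m, P m.
  by exists 0%N; apply/asboolP; exists (fun=> fun=> 0); split; case.
have Pbound m : P m -> (m <= Num.bound (dot k k ^+ 2 / L ^+ 2))%N.
  move=> /asboolP[e /eigen_orthonormal_bound em]; rewrite -(ler_nat R) ltW//.
  apply: le_lt_trans (archi_boundP _); last by rewrite divr_ge0// sqr_ge0.
  by rewrite ler_pdivlMr// exprn_gt0.
case: (ex_maxnP P0 Pbound) => m /asboolP[e [eE eO]] maxm.
exists m, e; split=> // f ef.
have ue i : ucont (e i) by case: (eE i).
have uf : ucont f by case: ef.
pose h x := f x - \sum_i dot f (e i) * e i x.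
have eh : eigen h by apply: eigenB => //; apply: eigen_sum => i; exact: eigenZ.
have uh : ucont h by case: eh.
have hO i : dot h (e i) = 0.
  rewrite (dotBl tbN)//; last by apply: ucont_sum => // j; exact: ucontZ.
  rewrite (dot_suml tbN)//; last by move=> j; exact: ucontZ.
  rewrite (bigD1 i)//= (dotZl tbN)// eO eqxx mulr1 big1 ?addr0 ?subrr// => j ji.
  by rewrite (dotZl tbN)// eO (negPf ji) mulr0.
have [h0 x|h0] := eqVneq (dot h h) 0.
  by apply/eqP; rewrite -subr_eq0; apply/eqP; exact: (dot_eq0 tbN uh h0).
have hp : 0 < dot h h by rewrite lt0r h0 (dot_ge0 tbN).
pose c := (Num.sqrt (dot h h))^-1.
have c2 : c * (c * dot h h) = 1.
  by rewrite mulrA -expr2 exprVn sqr_sqrtr ?ltW// mulVf.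
suff /maxm : P m.+1 by rewrite ltnn.
apply/asboolP; exists (fun i =>
  if unlift ord_max i is Some j then e j else fun x => c * h x).
split=> [i|i j]; first by case: unliftP => [j|] _; [exact: eE|exact: eigenZ].
case: unliftP => [i' ->|->]; case: unliftP => [j' ->|->].
- by rewrite eO (inj_eq lift_inj).
- by rewrite (dotZr tbN)// dotC hO mulr0 eq_sym (negPf (neq_lift _ _)).
- by rewrite (dotZl tbN)// hO mulr0 (negPf (neq_lift _ _)).
- by rewrite (dotZl tbN)// ?(dotZr tbN)// ?c2 ?eqxx//; exact: ucontZ.
Qed.

(** [conv k] commutes with right translations, so they act on the eigenspace, orthogonally by
    invariance of [dot]. Expanding f(1 x) in the basis exhibits f as a combination of coefficients
    of this action. *)
Lemma eigen_trig f : eigen f -> trig f.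
Proof.
move=> ef; have [m [e [[eE eO] eB]]] := eigen_basis.
have ue i : ucont (e i) by case: (eE i).
have ueb i b : ucont (fun x => e i (x * b)%g) by exact: ucont_mulr.
pose phi (a : G) : 'M[R]_m := \matrix_(i, j) dot (fun x => e j (x * a)%g) (e i).
have phiE (a : G) i x : e i (x * a)%g = \sum_j phi a j i * e j x.
  rewrite (eB _ (eigen_mulr a (eE i)) x); apply: eq_bigr => j _.
  by rewrite mxE.
exists m, phi, (\matrix_(i, j) (dot f (e i) * e j 1%g)).
split; last first.
  move=> x; rewrite (eB _ ef) mxtrace_mulE; apply: eq_bigr => i _.
  rewrite -[in LHS](mul1g x) phiE mulr_sumr; apply: eq_bigr => j _.
  by rewrite [in RHS]mxE; ring.
split.
- move=> x; apply/mulmx1C/matrixP => i j; rewrite mxE.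
  under eq_bigr do rewrite mxE.
  transitivity (dot (fun y => e i (y * x)%g) (fun y => e j (y * x)%g)).
    rewrite (_ : (fun y => e j (y * x)%g) = fun y => \sum_l phi x l j * e l y).
      rewrite (dot_sumr tbN)//; last by move=> l; exact: ucontZ.
      by apply: eq_bigr => l _; rewrite (dotZr tbN)// mulrC [phi x l i]mxE.
    by apply/funext => y.
  by rewrite (dot_translate tbN)// eO mxE.
- move=> x y; apply/matrixP => i j; rewrite !mxE.
  transitivity (dot (fun z => \sum_l phi y l j * e l (z * x)%g) (e i)).
    by congr dot; apply/funext => z; rewrite mulgA phiE.
  rewrite (dot_suml tbN)//; last by move=> l; exact: ucontZ.
  by apply: eq_bigr => l _; rewrite (dotZl tbN)// mulrC [phi x i l]mxE.
- move=> i j d d0; have [V NV eV] := ue j d d0.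
  exists V => // x v y Vv; rewrite !mxE -(dotBl tbN)//.
  rewrite ler_norm_sqr ?(ltW d0)//.
  have ud := ucontB tbN (ueb j (x * v * y)%g) (ueb j (x * y)%g).
  apply: (le_trans (cauchy_schwarz tbN ud (ue i))); rewrite eO eqxx mulr1.
  rewrite -[leRHS](mean_cst tbN); apply: (le_mean tbN) => [||z].
  + exact: ucontM.
  + exact: ucont_cst.
  by rewrite -expr2 -ler_norm_sqr ?(ltW d0)//; have := eV (z * x)%g v y Vv;
    rewrite !mulgA.
Qed.
End Eigenspace.
End PeterWeyl.

(** * Uniform approximation by trigonometric polynomials *)

Section PeterWeylDensity.
Variables (R : realType) (G : groupType) (N : set (set G)).
Hypothesis tbN : tb_filter N.
Implicit Types (f g h p : G -> R).

Let filtN : Filter N := tbf_filter tbN.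
#[local] Existing Instance filtN.
Local Notation ucont := (ucont N).
Local Notation trig := (trig N).

Lemma eventually_small (C e : R) : 0 <= C -> 0 < e ->
  exists n0, forall n, (n0 <= n)%N -> C * n.+1%:R^-1 <= e.
Proof.
move=> C0 e0; exists (Num.bound (C / e)) => n n0.
rewrite ler_pdivrMr ?ltr0n// mulrC -ler_pdivrMr// ltW//.
apply: lt_le_trans (archi_boundP _) _; first by rewrite divr_ge0// ltW.
by rewrite ler_nat (leq_trans n0).
Qed.

Lemma dot_dist f g h e B : ucont f -> ucont g -> ucont h ->
  (forall x, `|f x - g x| <= e) -> (forall x, `|h x| <= B) ->
  `|dot f h - dot g h| <= e * B.
Proof.
move=> uf ug uh fg hB; apply: (mean_dist tbN) => [||x]; try exact: ucontM.
by rewrite -mulrBl normrM; apply: ler_pM.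
Qed.

Variable k : G -> R.
Hypotheses (uk : ucont k) (symk : forall x, k x^-1%g = k x).
Local Notation T := (conv k).

Definition trig_perp f := ucont f /\ forall p, trig p -> dot f p = 0.

Lemma trig_perp_conv f : trig_perp f -> trig_perp (T f).
Proof.
move=> [uf fp]; split=> [|p pt]; first exact: ucont_conv.
have up := trig_ucont tbN pt.
by rewrite (conv_dot tbN)//; apply: fp; exact: trig_conv.
Qed.

Lemma dot_conv_le f : ucont f -> dot (T f) (T f) <= dot k k * dot f f.
Proof.
move=> uf; have uTf := ucont_conv tbN uk uf.
rewrite -[leRHS](mean_cst tbN); apply: (le_mean tbN) => [||x].
- exact: ucontM.
- exact: ucont_cst.
by rewrite -expr2 (conv_sqr_le tbN).
Qed.

(* The supremum [L] of |Tf|^2 over the unit ball of the orthogonal complement is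
   an eigenvalue of T^2 there, by compactness; its eigenspace being
   finite-dimensional, eigenfunctions are both trigonometric polynomials and
   orthogonal to them. *)
Lemma trig_perp_conv0 f : trig_perp f -> forall x, T f x = 0.
Proof.
move=> pf x0; apply/eqP/negPn/negP => Tfx0.
pose A := [set c | exists2 h,
  trig_perp h & dot h h <= 1 /\ c = dot (T h) (T h)].
have k0 := dot_ge0 tbN uk.
have ubA : ubound A (dot k k).
  move=> _ [h [uh _] [h1 ->]];
    rewrite (le_trans (dot_conv_le uh))// -[leRHS]mulr1.
  by rewrite ler_wpM2l.
have normalized h : trig_perp h -> 0 < dot h h -> A (dot (T h) (T h) / dot h h).
  move=> [uh hp] h0; pose c := (Num.sqrt (dot h h))^-1.
  have c2 : c ^+ 2 = (dot h h)^-1 by rewrite exprVn sqr_sqrtr// ltW.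
  have uch : ucont (fun x => c * h x) by exact: ucontZ.
  have uTh : ucont (T h) by exact: ucont_conv.
  exists (fun x => c * h x); first split=> [//|p pt].
    by rewrite (dotZl tbN)// ?hp ?mulr0//; exact: trig_ucont pt.
  split; first by rewrite (dotZl tbN)// (dotZr tbN)// mulrA -expr2 c2 mulVf
    ?gt_eqF.
  rewrite (_ : T (fun x => c * h x) = fun x => c * T h x); last first.
    by apply/funext => y; rewrite (convZ tbN).
  by rewrite (dotZl tbN)// ?(dotZr tbN)//;
    [rewrite mulrA -expr2 c2 mulrC|exact: ucontZ].
have uf := pf.1; have uTf := ucont_conv tbN uk uf.
have f0 : 0 < dot f f.
  rewrite lt0r (dot_ge0 tbN)// andbT; apply: contra Tfx0 => /eqP f0.
  have := conv_sqr_le tbN uk x0 uf; rewrite f0 mulr0 => le0.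
  by rewrite -sqrf_eq0 eq_le le0 sqr_ge0.
have Tf0 : 0 < dot (T f) (T f).
  rewrite lt0r (dot_ge0 tbN)// andbT; apply: contra Tfx0 => /eqP Tf0.
  exact/eqP/(dot_eq0 tbN uTf Tf0).
have supA : has_sup A by split; [exists (dot (T f) (T f) / dot f f);
  exact: normalized|exists (dot k k)].
pose L := sup A.
have L0 : 0 < L.
  by apply: (@lt_le_trans _ _ (dot (T f) (T f) / dot f f));
    [rewrite divr_gt0|exact/(ub_le_sup supA.2)/normalized].
have Lle h : trig_perp h -> dot (T h) (T h) <= L * dot h h.
  move=> ph; have [h0|h0] := eqVneq (dot h h) 0.
    by rewrite h0 mulr0; have := dot_conv_le ph.1; rewrite h0 mulr0.
  have hp : 0 < dot h h by rewrite lt0r h0 (dot_ge0 tbN)//; case: ph.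
  by rewrite -ler_pdivrMr//; exact/(ub_le_sup supA.2)/normalized.
have /choice[F FP] n : exists h, [/\ trig_perp h,
  dot h h <= 1 & L - n.+1%:R^-1 < dot (T h) (T h)].
  have [|c [h ph [h1 ->]] hL] := @sup_adherent _ A n.+1%:R^-1 _ supA.
    by rewrite invr_gt0.
  by exists h.
have uF n : ucont (F n) by have [[]] := FP n.
have uTF n : ucont (T (F n)) by exact: ucont_conv.
have uTTF n : ucont (T (T (F n))) by exact: ucont_conv.
have [g ug gF] := conv_precompact tbN uk uF (fun n =>
  let: And3 _ h _ := FP n in h).
have pg : trig_perp g.
  split=> // p pt; have up := trig_ucont tbN pt;
    have [B B0 pB] := ucont_bounded tbN up.
  apply: eqr_dist_le => e e0; have eB : 0 < e / B by rewrite divr_gt0.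
  have [n _ nF] := gF _ 0%N eB; have [pFn _ _] := FP n.
  have := dot_dist (uTF n) ug up nF pB.
  by rewrite (trig_perp_conv pFn).2// divfK ?gt_eqF// distrC.
(* Expand |T (T (F n)) - L * F n|^2, where the cross term is |T (F n)|^2 by symmetry. [Lle] for
   [T (F n)] leaves at most L * (L - |T (F n)|^2), which is below L / (n + 1). The outer T turns
   this L2 estimate into a pointwise one. *)
have residual n x : T (fun y =>
  T (T (F n)) y - L * F n y) x ^+ 2 <= dot k k * L * n.+1%:R^-1.
  have [pFn F1 FL] := FP n;
    have uLF : ucont (fun y => L * F n y) by exact: ucontZ.
  have ud := ucontB tbN (uTTF n) uLF.
  apply: (le_trans (conv_sqr_le tbN uk x ud)); rewrite -mulrA ler_wpM2l//.
  rewrite (dotBl tbN)// !(dotBr tbN)// !(dotZl tbN)// !(dotZr tbN)// (dotC (F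
    n)).
  rewrite (conv_dot tbN uk symk (uTF n) (uF n)).
  have := Lle _ (trig_perp_conv pFn); have := Lle _ pFn.
  have := dot_ge0 tbN (uF n); move: F1 FL; set a := dot _ _; set b := dot _ _;
    set c := dot _ _.
  have : 0 < n.+1%:R^-1 :> R by rewrite invr_gt0.
  set d := _^-1 => *; nra.
have eg : eigen N k L g.
  split=> // x; apply: eqr_dist_le => e e0.
  have [B B0 kB] := ucont_bounded tbN uk.
  have e3 : 0 < e / 3 by lra.
  have kL0 : 0 <= dot k k * L by rewrite mulr_ge0// ltW.
  have [n0 n0P] := eventually_small kL0 (exprn_gt0 2 e3).
  have BL0 : 0 < B * B + L by rewrite addr_gt0// mulr_gt0.
  have eBL : 0 < e / 3 / (B * B + L) by rewrite divr_gt0.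
  have [n /n0P nk nF] := gF _ n0 eBL.
  have uTg : ucont (T g) by exact: ucont_conv.
  have d1 := conv_dist tbN uk (uTTF n) uTg kB (conv_dist tbN uk (uTF n) ug kB
    nF) x.
  have d2 : `|T (fun y => T (T (F n)) y - L * F n y) x| <= e / 3.
    by rewrite ler_norm_sqr ?(ltW e3)// (le_trans (residual n x)).
  have d3 : `|L * (T (F n) x - g x)| <= L * (e / 3 / (B * B + L)).
    by rewrite normrM (ger0_norm (ltW L0)) ler_wpM2l// ltW.
  move: d2; rewrite (convB tbN)//; last exact: ucontZ.
  rewrite (convZ tbN)// => d2.
  have sum : B * (B * (e / 3 / (B * B + L))) + L * (e / 3 / (B * B + L)) = e /
    3.
    by field; rewrite gt_eqF.
  move: d1 d2 d3; rewrite mulrBr.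
  rewrite !ler_norml => /andP[? ?] /andP[? ?] /andP[? ?].
  by apply/andP; split; lra.
have g0 := dot_eq0 tbN ug (pg.2 g (eigen_trig tbN uk symk L0 eg)).
(* Now [T (F n)] accumulates uniformly at 0, against |T (F n)|^2 > L - 1 / (n + 1). *)
have L2 : 0 < L / 2 by lra.
have [n0 n0P] := eventually_small (@ler01 R) L2.
have sq0 : 0 < Num.sqrt (L / 2) by rewrite sqrtr_gt0.
have [n /n0P nL nF] := gF _ n0 sq0.
have : dot (T (F n)) (T (F n)) <= L / 2.
  rewrite -[leRHS](mean_cst tbN); apply: (le_mean tbN) => [||x].
  - exact: ucontM.
  - exact: ucont_cst.
  have := nF x; rewrite g0 subr0 ler_norm_sqr ?sqrtr_ge0// sqr_sqrtr ?(ltW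
    L2)//.
have [_ _] := FP n; move: nL; rewrite mul1r; set d := _^-1; lra.
Qed.

(* The residuals of a minimizing sequence of trigonometric polynomials are
   asymptotically orthogonal to them, so that T maps them to functions that
   accumulate at a point of the orthogonal complement, where T vanishes. *)
Lemma conv2_approx f : ucont f -> forall e, 0 < e ->
  exists2 p, trig p & forall x, `|T (T f) x - p x| <= e.
Proof.
move=> uf e e0.
pose res p x := f x - p x.
have ures p : trig p -> ucont (res p) by move=> pt; apply: ucontB => //;
  exact: trig_ucont pt.
pose A := [set c | exists2 p, trig p & c = dot (res p) (res p)].
have infA : has_inf A.
  split; first by exists (dot (res (fun=> 0)) (res (fun=> 0))), (fun=> 0) =>
    //; exact: trig0.
  by exists 0 => _ [p pt ->]; apply: (dot_ge0 tbN); exact: ures.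
have /choice[P PP] n : exists p,
  trig p /\ dot (res p) (res p) < inf A + n.+1%:R^-1.
  have [|c [p pt ->] pc] := @inf_adherent _ A n.+1%:R^-1 _ infA;
    first by rewrite invr_gt0.
  by exists p.
pose F n := res (P n).
have uF n : ucont (F n) by apply: ures; case: (PP n).
have uTF n : ucont (T (F n)) by exact: ucont_conv.
have FC n : dot (F n) (F n) <= inf A + 1.
  have [_ /ltW/le_trans] := PP n; apply; rewrite lerD2l invf_le1 ?ltr0n//.
  by rewrite ler1n.
have asymp n p : trig p -> dot (F n) p ^+ 2 <= dot p p * n.+1%:R^-1.
  move=> pt; have up := trig_ucont tbN pt.
  have [p0|p0] := eqVneq (dot p p) 0.
    by have := cauchy_schwarz tbN (uF n) up; rewrite p0 mulr0 mul0r.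
  have pp : 0 < dot p p by rewrite lt0r p0 (dot_ge0 tbN).
  pose c := dot (F n) p / dot p p.
  have Ac : A (dot (fun x => F n x - c * p x) (fun x => F n x - c * p x)).
    (* Removing from [F n] its component along p leaves the residual of another trigonometric
       polynomial, so its squared norm is still at least the infimum. *)
    exists (fun x => c * p x + P n x); first by apply: trig_lin => //;
      case: (PP n).
    by congr dot; apply/funext => x; rewrite /F /res; ring.
  have := ge_inf infA.2 Ac; have [_] := PP n; rewrite -/(F n).
  rewrite (dot_residual tbN (uF n) up p0).
  rewrite -ler_pdivrMl//; set d := n.+1%:R^-1; lra.
have [g ug gF] := conv_precompact tbN uk uF FC.
have pg : trig_perp g.
  split=> // p pt; have up := trig_ucont tbN pt;
    have [B B0 pB] := ucont_bounded tbN up.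
  have Tpt : trig (T p) by exact: trig_conv.
  apply: eqr_dist_le => d d0; have d2 : 0 < d / 2 by lra.
  have dB : 0 < d / 2 / B by rewrite divr_gt0.
  have TT0 : 0 <= dot (T p) (T p) by apply: (dot_ge0 tbN);
    exact: trig_ucont Tpt.
  have [n0 n0P] := eventually_small TT0 (exprn_gt0 2 d2).
  have [n /n0P nTT nF] := gF _ n0 dB.
  have := dot_dist (uTF n) ug up nF pB; rewrite divfK ?gt_eqF//.
  have : `|dot (T (F n)) p| <= d / 2.
    by rewrite (conv_dot tbN)// ler_norm_sqr ?(ltW d2)// (le_trans (asymp n _
      Tpt)).
  by rewrite !ler_norml => /andP[? ?] /andP[? ?]; apply/andP; split; lra.
have [B B0 kB] := ucont_bounded tbN uk.
have eB : 0 < e / B by rewrite divr_gt0.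
have [n _ nF] := gF _ 0%N eB; have [Pt _] := PP n.
exists (T (T (P n))); first by do 2 apply: trig_conv => //.
move=> x; have := conv_dist tbN uk (uTF n) ug kB nF x.
(* Since T g = 0, the closeness of [T (F n)] to g says that T (T f) is close to T (T (P n)). *)
rewrite (trig_perp_conv0 pg) subr0 mulrC divfK ?gt_eqF//.
have uP : ucont (P n) by exact: trig_ucont Pt.
rewrite (_ : T (F n) = fun x => T f x - T (P n) x); last first.
  by apply/funext => y; rewrite /F /res (convB tbN).
by rewrite (convB tbN)//; exact: ucont_conv.
Qed.

End PeterWeylDensity.

(** The triple convolution of a bump k is positive at 1 and vanishes outside U, by the choice of V
    and W. If x is outside U, a uniformly close trigonometric polynomial must differ noticeably at x
    and 1, hence so must [phi x] and the identity. *)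
Lemma nbhs_orth_rep (R : realType) (G : groupType) (N : set (set G)) (U : set
  G) :
  tb_filter N -> N U ->
  exists n (phi : G -> 'M[R]_n) d, [/\ orth_rep N phi, 0 < d &
    forall x, (forall i j, `|phi x i j - (i == j)%:R| <= d) -> U x].
Proof.
move=> tbN NU.
have [V NV VU] := tbf_mul tbN NU; have [W NW WV] := tbf_mul tbN NV.
have NVW : N (V `&` W) by apply: (@filterI _ _ (tbf_filter tbN)).
have [k [uk k0 k1 symk kU]] := ucont_bump R tbN NVW.
have uTk := ucont_conv tbN uk uk; have uTTk := ucont_conv tbN uk uTk.
have Tk0 x : 0 <= conv k k x.
  apply: (mean_ge0 tbN) => [|y]; last exact: mulr_ge0.
  by apply: ucontM => //; exact: ucont_kernel.
have Tk1 : 0 < conv k k 1%g.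
  apply: (mean_gt0 tbN) => [|y|]; last by rewrite mul1g invg1 mulr_gt0.
    by apply: ucontM => //; exact: ucont_kernel.
  exact: mulr_ge0.
have TTk1 : 0 < conv k (conv k k) 1%g.
  apply: (mean_gt0 tbN) => [|y|]; last by rewrite mul1g invg1 mulr_gt0.
    by apply: ucontM => //; exact: ucont_kernel.
  exact: mulr_ge0.
have Tksupp x : conv k k x != 0 -> V x.
  apply: contraPP => nVx; apply/negP/negPn/eqP.
  rewrite -[RHS](mean_cst tbN); congr mean; apply/funext => y; apply/eqP.
  rewrite mulf_eq0; apply/orP; have [|kxy] := boolP (k (x * y^-1)%g == 0);
    first by left.
  right; apply/negPn/negP => ky; apply: nVx.
  by have := WV _ _ (kU _ kxy).2 (kU _ ky).2; rewrite mulgVK.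
have TTksupp x : conv k (conv k k) x != 0 -> U x.
  apply: contraPP => nUx; apply/negP/negPn/eqP.
  rewrite -[RHS](mean_cst tbN); congr mean; apply/funext => y; apply/eqP.
  rewrite mulf_eq0; apply/orP; have [|kxy] := boolP (k (x * y^-1)%g == 0);
    first by left.
  right; apply/negPn/negP => ky; apply: nUx.
  by have := VU _ _ (kU _ kxy).1 (Tksupp _ ky); rewrite mulgVK.
(* Outside U the value c at 1 would be at most c / 3 + c / 3 + c / 4 < c: two approximation errors
   and the variation of p. The 1 added in [S] only keeps it positive. *)
set c := conv k (conv k k) 1%g in TTk1; have c3 : 0 < c / 3 by lra.
have [p [n [phi [A [phir pE]]]] pk] := conv2_approx tbN uk symk uk c3.
pose S := \sum_i \sum_j `|A i j| + 1.
have S0 : 0 < S.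
  by apply: ltr_wpDl => //; apply: sumr_ge0 => i _; apply: sumr_ge0.
exists n, phi, (c / 4 / S); split=> // [|x phix]; first by rewrite divr_gt0//;
  lra.
apply: TTksupp; apply/eqP => kx.
have : `|p x - p 1%g| <= c / 4.
  have -> : p x - p 1%g = \tr (A *m (phi x - 1%:M)).
    by rewrite !pE (orth_rep1 phir) mulmxBr raddfB.
  rewrite mxtrace_mulE.
  rewrite (le_trans (ler_norm_sum _ _ _))//.
  apply: (@le_trans _ _ (\sum_i \sum_j `|A i j| * (c / 4 / S))).
    apply: ler_sum => i _; rewrite (le_trans (ler_norm_sum _ _ _))//.
    apply: ler_sum => j _; rewrite normrM ler_wpM2l//.
    by rewrite !mxE.
  under eq_bigr do rewrite -mulr_suml; rewrite -mulr_suml.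
  rewrite mulrA ler_pdivrMr// mulrC ler_pM2l; last by lra.
  by rewrite /S lerDl.
have := pk x; have := pk 1%g; rewrite kx -/c !ler_norml.
by move=> /andP[? ?] /andP[? ?] /andP[? ?]; lra.
Qed.

(** * Unitary representations and the Frobenius norm *)

Section Frobenius.
Variable R : realType.
Local Notation C := R[i].
Local Open Scope sesquilinear_scope.

Definition sqc (z : C) : R := complex.Re z ^+ 2 + complex.Im z ^+ 2.

Lemma sqcE z : (sqc z)%:C%C = z * z^*.
Proof. by rewrite -normCK add_Re2_Im2. Qed.

Lemma sqc_ge0 z : 0 <= sqc z.
Proof. by rewrite addr_ge0 ?sqr_ge0. Qed.

Lemma sqcM z1 z2 : sqc (z1 * z2) = sqc z1 * sqc z2.
Proof. by case: z1 => a b; case: z2 => c d; rewrite /sqc /=; ring. Qed.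

Lemma sqcD_le z1 z2 : sqc (z1 + z2) <= 2 * sqc z1 + 2 * sqc z2.
Proof.
case: z1 => a b; case: z2 => c d; rewrite /sqc /=.
have := sqr_ge0 (a - c); have := sqr_ge0 (b - d); nra.
Qed.

Lemma sqcN z : sqc (- z) = sqc z.
Proof. by case: z => a b; rewrite /sqc /=; ring. Qed.

Lemma sqc_conj z : sqc z^* = sqc z.
Proof. by case: z => a b; rewrite /sqc /=; ring. Qed.

Lemma sqc_eq0 z : (sqc z == 0) = (z == 0).
Proof. by rewrite -(inj_eq (@complexI _)) sqcE mul_conjC_eq0. Qed.

(** The squared Frobenius norm. Squares keep everything polynomial; the price is a factor 2 in
    [frobD_le] in place of the triangle inequality. *)
Definition frob m n (A : 'M[C]_(m, n)) : R := \sum_i \sum_j sqc (A i j).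

Lemma frob_ge0 m n (A : 'M[C]_(m, n)) : 0 <= frob A.
Proof. by apply: sumr_ge0 => i _; apply: sumr_ge0 => j _; exact: sqc_ge0. Qed.

Lemma sqc_le_frob m n (A : 'M[C]_(m, n)) i j : sqc (A i j) <= frob A.
Proof.
rewrite /frob (bigD1 i)//= (bigD1 j)//= -addrA lerDl addr_ge0//.
  by apply: sumr_ge0 => *; exact: sqc_ge0.
by apply: sumr_ge0 => *; apply: sumr_ge0 => *; exact: sqc_ge0.
Qed.

Lemma frob_eq0 m n (A : 'M[C]_(m, n)) : (frob A == 0) = (A == 0).
Proof.
apply/eqP/eqP => [A0|->]; last first.
  by rewrite /frob big1// => i _; rewrite big1// => j _; rewrite mxE;
    apply/eqP; rewrite sqc_eq0.
apply/matrixP => i j; rewrite mxE; apply/eqP; rewrite -sqc_eq0 eq_le sqc_ge0.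
by rewrite -A0 sqc_le_frob.
Qed.

Lemma frob0 m n : frob (0 : 'M[C]_(m, n)) = 0.
Proof. by apply/eqP; rewrite frob_eq0. Qed.

Lemma frobE m n (A : 'M[C]_(m, n)) : (frob A)%:C%C = \tr (A *m A^t*).
Proof.
rewrite rmorph_sum; apply: eq_bigr => i _; rewrite rmorph_sum mxE.
by apply: eq_bigr => j _; rewrite /= sqcE !mxE.
Qed.

Lemma frobN m n (A : 'M[C]_(m, n)) : frob (- A) = frob A.
Proof. by apply: eq_bigr => i _; apply: eq_bigr => j _; rewrite mxE sqcN. Qed.

Lemma frobD_le m n (A B : 'M[C]_(m,
  n)) : frob (A + B) <= 2 * frob A + 2 * frob B.
Proof.
rewrite /frob !mulr_sumr -big_split; apply: ler_sum => i _.
rewrite !mulr_sumr -big_split; apply: ler_sum => j _.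
by rewrite mxE; exact: sqcD_le.
Qed.

Lemma frob_conj m n (A : 'M[C]_(m, n)) : frob (map_mx Num.conj A) = frob A.
Proof. by apply: eq_bigr => i _; apply: eq_bigr => j _;
  rewrite mxE sqc_conj. Qed.

Lemma frob_mull m n (U : 'M[C]_m) (A : 'M[C]_(m, n)) : U \is unitarymx ->
  frob (U *m A) = frob A.
Proof.
move=> uU; apply: (@complexI R); rewrite !frobE trmx_mul map_mxM.
rewrite mxtrace_mulC -!mulmxA (mulmxA _ U) (_ : U^t* *m U = 1%:M).
  by rewrite mul1mx mxtrace_mulC.
by apply/mulmx1C/unitarymxP.
Qed.

Lemma frob_mulr m n (U : 'M[C]_n) (A : 'M[C]_(m, n)) : U \is unitarymx ->
  frob (A *m U) = frob A.
Proof.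
move=> /unitarymxP uU; apply: (@complexI R); rewrite !frobE trmx_mul map_mxM.
by rewrite -mulmxA (mulmxA U) uU mul1mx.
Qed.

Lemma invmx_unitarymx n (U : 'M[C]_n) : U \is unitarymx ->
  invmx U \is unitarymx.
Proof. by move=> uU; rewrite (invmx_unitary uU) trmxC_unitary. Qed.

Lemma frob_unitary n (U : 'M[C]_n) : U \is unitarymx -> frob U = n%:R.
Proof.
move=> /unitarymxP uU; apply: (@complexI R).
by rewrite frobE uU mxtrace1 rmorph_nat.
Qed.

Lemma frob_block m1 m2 n1 n2 (A : 'M[C]_(m1, n1)) B D (E : 'M[C]_(m2, n2)) :
  frob (block_mx A B D E) = frob A + frob B + frob D + frob E.
Proof.
rewrite /frob big_split_ord /= -2!addrA !addrA -addrA; congr (_ + _).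
  rewrite -big_split; apply: eq_bigr => i _; rewrite big_split_ord.
  by congr (_ + _); apply: eq_bigr => j _; rewrite (block_mxEul, block_mxEur).
rewrite -big_split; apply: eq_bigr => i _; rewrite big_split_ord.
by congr (_ + _); apply: eq_bigr => j _; rewrite (block_mxEdl, block_mxEdr).
Qed.

Lemma tens_mx11 m n : (1%:M : 'M[C]_m) *t (1%:M : 'M[C]_n) = 1%:M.
Proof.
apply/matrixP => i j; case: (mxtens_indexP i) => i1 i2.
case: (mxtens_indexP j) => j1 j2; rewrite tensmxE !mxE.
by rewrite (can_eq (@mxtens_indexK _ _)) xpair_eqE -natrM mulnb.
Qed.

Lemma frob_tens m n p q (A : 'M[C]_(m, n)) (B : 'M[C]_(p, q)) :
  frob (A *t B) = frob A * frob B.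
Proof.
rewrite /frob mulr_sum; apply: eq_bigr => i _; rewrite mulr_sum.
by apply: eq_bigr => j _; rewrite mxE sqcM.
Qed.

Lemma mxtrace_tens m n (A : 'M[C]_m) (B : 'M[C]_n) : \tr (A *t B) = \tr A * \tr
  B.
Proof. by rewrite /mxtrace mulr_sum; apply: eq_bigr => i _; rewrite mxE. Qed.

Lemma ler_sum_inj (I J : finType) (f : I -> J) (F : J -> R) : injective f ->
  (forall j, 0 <= F j) -> \sum_i F (f i) <= \sum_j F j.
Proof.
move=> injf F0; have -> : \sum_i F (f i) = \sum_(j in map f (enum I)) F j.
  have u : uniq (map f (enum I)) by rewrite map_inj_uniq ?enum_uniq.
  by rewrite -(big_uniq _ u) big_map big_enum.
by rewrite [leRHS](bigID (mem (map f (enum I))))/= lerDl sumr_ge0.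
Qed.

Lemma frob_mxsub m n m' n' (f : 'I_m' -> 'I_m) (g : 'I_n' -> 'I_n)
  (A : 'M[C]_(m, n)) : injective f -> injective g ->
  frob (mxsub f g A) <= frob A.
Proof.
move=> injf injg; apply: (@le_trans _ _ (\sum_i \sum_k sqc (A (f i) k))).
  apply: ler_sum => i _.
  rewrite (eq_bigr (fun j => sqc (A (f i) (g j)))) => [|j _];
    last by rewrite mxE.
  by apply: (ler_sum_inj (F := fun k => sqc (A (f i) k))) => // k;
    exact: sqc_ge0.
apply: (ler_sum_inj (F := fun l => \sum_k sqc (A l k))) => // l.
by apply: sumr_ge0 => k _; exact: sqc_ge0.
Qed.

Lemma frob_mxdiag m (p : 'I_m -> nat) (B : forall j, 'M[C]_(p j)) j :
  frob (B j) <= frob (\mxdiag_j B j).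
Proof.
have inj : injective (tagnat.Rank (p_ := p) j).
  by move=> i k ik; have := tagnat.eq_Rank i k;
    rewrite ik !eqxx => /esym/eqP/val_inj.
rewrite -{1}[B j](@submxblock_diag _ _ p B j); exact: frob_mxsub.
Qed.
End Frobenius.

(** * Distance of a unitary representation to the identity *)

Section Representations.
Variables (R : realType) (G : groupType).
Local Notation C := R[i].
Local Open Scope sesquilinear_scope.

Lemma rep_n1 n (phi : G -> 'M[C]_n) : rep_n phi -> phi 1%g = 1%:M.
Proof.
move=> [_ /(_ 1%g)/unitarymxP phiU phiM].
have := congr1 (fun M => M *m (phi 1%g)^t*) (phiM 1%g 1%g).
by rewrite mulg1 -mulmxA phiU mulmx1.
Qed.

Lemma rep_nV n (phi : G -> 'M[C]_n) x : rep_n phi -> phi x^-1%g = (phi x)^t*.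
Proof.
move=> phir; have [_ /(_ x)/unitarymxP phiU phiM] := phir.
by rewrite -[RHS]mul1mx -(rep_n1 phir) -(mulVg x) phiM -mulmxA phiU mulmx1.
Qed.

(** Squared distance from [phi x] to the identity. As multiplication by unitaries preserves [frob],
    it induces a bi-invariant squared distance on G ([defect_dist]). *)
Definition defect n (phi : G -> 'M[C]_n) (x : G) : R := frob (phi x - 1%:M).

Lemma defect_ge0 n (phi : G -> 'M[C]_n) x : 0 <= defect phi x.
Proof. exact: frob_ge0. Qed.

Lemma defect1 n (phi : G -> 'M[C]_n) : rep_n phi -> defect phi 1%g = 0.
Proof. by move=> phir; apply/eqP; rewrite frob_eq0 (rep_n1 phir) subrr. Qed.

Lemma defect_dist n (phi : G -> 'M[C]_n) x v y : rep_n phi ->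
  frob (phi (x * v * y)%g - phi (x * y)%g) = defect phi v.
Proof.
move=> [_ phiU phiM]; rewrite !phiM -mulmxBl frob_mulr//.
by rewrite -{2}[phi x]mulmx1 -mulmxBr frob_mull.
Qed.

Lemma defectM_le n (phi : G -> 'M[C]_n) x y : rep_n phi ->
  defect phi (x * y)%g <= 2 * defect phi x + 2 * defect phi y.
Proof.
move=> phir; rewrite /defect.
have -> : phi (x * y)%g - 1%:M = (phi x - 1%:M) + (phi (x * y)%g - phi x).
  by rewrite [RHS]addrC addrA subrK.
apply: (le_trans (frobD_le _ _)); rewrite lerD2l.
by have := defect_dist x y 1%g phir; rewrite !mulg1 => ->.
Qed.

Lemma defect_conjg n (phi : G -> 'M[C]_n) x y : rep_n phi ->
  defect phi (x * y * x^-1)%g = defect phi y.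
Proof.
move=> phir; rewrite -(defect_dist x y x^-1%g phir) mulgV.
by rewrite (rep_n1 phir).
Qed.

Lemma defectV n (phi : G -> 'M[C]_n) x : rep_n phi ->
  defect phi x^-1%g = defect phi x.
Proof.
move=> phir; have := defect_dist 1%g x x^-1%g phir.
by rewrite !mul1g mulgV (rep_n1 phir) -opprB frobN.
Qed.

Lemma Re_sum I (r : seq I) (F : I -> C) :
  complex.Re (\sum_(i <- r) F i) = \sum_(i <- r) complex.Re (F i).
Proof.
elim: r => [|i r IH]; first by rewrite !big_nil.
by rewrite !big_cons -IH; case: (F i) => a b; case: (\sum_(_ <- _) _).
Qed.

(** Expanding the square, unitarity turns |phi x|^2 into n and only the diagonal entries are left.
    This ties neighborhoods of 1 to characters. *)
Lemma defect_tr n (phi : G -> 'M[C]_n) x : rep_n phi ->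
  defect phi x = 2 * n%:R - 2 * complex.Re (\tr (phi x)).
Proof.
move=> [_ phiU _].
have -> : 2 * n%:R - 2 * complex.Re (\tr (phi x)) =
    frob (phi x) + \sum_(i < n) (1 - 2 * complex.Re (phi x i i)).
  rewrite (frob_unitary (phiU x)) sumrB sumr_const card_ord Re_sum mulr_sumr.
  by ring.
rewrite -big_split; apply: eq_bigr => i _ /=.
rewrite (bigD1 i)//= [in RHS](bigD1 i)//= addrAC; congr (_ + _).
  by rewrite !mxE eqxx; case: (phi x i i) => a b; rewrite /sqc /=; ring.
by apply: eq_bigr => j ji; rewrite !mxE eq_sym (negPf ji) subr0.
Qed.

Lemma defect_le n (phi : G -> 'M[C]_n) x : rep_n phi -> defect phi x <= 4 *
  n%:R.
Proof.
move=> [_ phiU _]; apply: (le_trans (frobD_le _ _)).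
rewrite frobN (frob_unitary (phiU x)) frob_unitary; first by lra.
by apply/unitarymxP; rewrite trmx1 map_mx1 mulmx1.
Qed.

Section RepOperations.
Variables (n m : nat) (phi : G -> 'M[C]_n) (psi : G -> 'M[C]_m).
Hypotheses (phir : rep_n phi) (psir : rep_n psi).

Lemma rep_n_sum : rep_n (rep_sum phi psi).
Proof.
have [n0 phiU phiM] := phir; have [m0 psiU psiM] := psir; split.
- by rewrite addn_gt0 n0.
- move=> x; apply/unitarymxP; rewrite tr_block_mx map_block_mx !trmx0 !map_mx0.
  rewrite mulmx_block !mulmx0 !mul0mx !addr0 !add0r.
  by rewrite (unitarymxP (phiU x)) (unitarymxP (psiU x)) -scalar_mx_block.
- move=> x y; rewrite /rep_sum mulmx_block !mulmx0 !mul0mx !addr0 !add0r.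
  by rewrite phiM psiM.
Qed.

Lemma defect_sum x : defect (rep_sum phi psi) x = defect phi x + defect psi x.
Proof.
rewrite /defect /rep_sum scalar_mx_block opp_block_mx add_block_mx frob_block.
by rewrite !subr0 !frob0 !addr0.
Qed.

Lemma rep_n_tensor : rep_n (rep_tensor phi psi).
Proof.
have [n0 phiU phiM] := phir; have [m0 psiU psiM] := psir; split.
- by rewrite muln_gt0 n0.
- move=> x; apply/unitarymxP; rewrite trmx_tens map_mxT tensmx_mul.
  by rewrite (unitarymxP (phiU x)) (unitarymxP (psiU x)) tens_mx11.
- by move=> x y; rewrite /rep_tensor tensmx_mul phiM psiM.
Qed.

Lemma defect_tensor_le x :
  defect (rep_tensor phi psi) x <= 2 * m%:R * defect phi x + 2 * n%:R * defect
    psi x.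
Proof.
have [n0 phiU phiM] := phir; have [m0 psiU psiM] := psir;
  rewrite /defect /rep_tensor.
have -> : phi x *t psi x - 1%:M = (phi x - 1%:M) *t psi x + 1%:M *t (psi x -
  1%:M).
  apply/matrixP => i j; case: (mxtens_indexP i) => i1 i2;
    case: (mxtens_indexP j) => j1 j2.
  have -> : 1%:M = (1%:M : 'M[C]_n) *t (1%:M : 'M[C]_m) by rewrite tens_mx11.
  have EB k (A B : 'M[C]_k) a b : (A - B) a b = A a b - B a b by rewrite !mxE.
  by rewrite EB [in RHS]mxE !tensmxE !EB; ring.
apply: (le_trans (frobD_le _ _)); rewrite !frob_tens (frob_unitary (psiU x)).
rewrite (@frob_unitary _ _ 1%:M); first by lra.
by apply/unitarymxP; rewrite trmx1 map_mx1 mulmx1.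
Qed.

Lemma rep_n_conj : rep_n (rep_conj phi).
Proof.
have [n0 phiU phiM] := phir; split; first exact: n0.
  by move=> x; rewrite conjC_unitary; exact: phiU.
by move=> x y; rewrite /rep_conj phiM map_mxM.
Qed.

Lemma defect_conj x : defect (rep_conj phi) x = defect phi x.
Proof.
by rewrite /defect /rep_conj -(frob_conj (phi x - _)) map_mxB map_mx1.
Qed.

Lemma rep_n_similar (A : 'M[C]_n) : A \is unitarymx -> rep_n (rep_similar A
  phi).
Proof.
move=> uA; have [n0 phiU phiM] := phir; split; first exact: n0.
  by move=> x; exact: mul_unitarymx (mul_unitarymx (invmx_unitarymx uA) _) uA.
by move=> x y; rewrite /rep_similar phiM -!mulmxA mulKVmx// unitarymx_unit.
Qed.

Lemma defect_similar (A : 'M[C]_n) x : A \is unitarymx ->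
  defect (rep_similar A phi) x = defect phi x.
Proof.
move=> uA; rewrite /defect /rep_similar.
have -> : invmx A *m phi x *m A - 1%:M = invmx A *m (phi x - 1%:M) *m A.
  by rewrite mulmxBr mulmxBl mulmx1 mulVmx// unitarymx_unit.
by rewrite (frob_mulr _ uA) (frob_mull _ (invmx_unitarymx uA)).
Qed.

End RepOperations.

Lemma rep_n_trivial : rep_n (@rep_trivial R G).
Proof.
split=> // [x|x y]; last by rewrite /rep_trivial mulmx1.
by apply/unitarymxP; rewrite /rep_trivial trmx1 map_mx1 mulmx1.
Qed.

Lemma defect_trivial x : defect (@rep_trivial R G) x = 0.
Proof. by apply/eqP; rewrite frob_eq0 subrr. Qed.

Lemma defect_summand m (p : 'I_m -> nat) (phi : forall j,
  G -> 'M[C]_(p j)) j x :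
  defect (phi j) x <= defect (rep_bigsum phi) x.
Proof.
rewrite /defect /rep_bigsum -mxdiagZ -mxdiagB.
exact: (frob_mxdiag (fun j => phi j x - 1%:M)).
Qed.

End Representations.

Section ContinuousRepresentations.
Variables (R : realType) (G : groupType) (N : set (set G)).
Local Notation C := R[i].
Local Open Scope sesquilinear_scope.

(** Continuity at 1 only; for a homomorphism it gives uniform continuity of the entries
    ([ucont_entry]). *)
Definition rep_continuous n (phi : G -> 'M[C]_n) : Prop :=
  forall e, 0 < e -> N [set x | defect phi x < e].

Lemma ucont_entry n (phi : G -> 'M[C]_n) i j : rep_n phi -> rep_continuous phi
  ->
  ucont N (fun x => complex.Re (phi x i j)) /\
  ucont N (fun x => complex.Im (phi x i j)).
Proof.
move=> phir phic; split=> e e0; exists [set x | defect phi x < e ^+ 2];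
    try exact/phic/exprn_gt0;
  move=> x v y /= vV; rewrite ler_norm_sqr ?(ltW e0)//;
  apply: le_trans (ltW vV); rewrite -(defect_dist x v y phir);
  apply: le_trans (sqc_le_frob _ i j); rewrite !mxE /sqc;
  case: (phi (x * v * y)%g i j) => a b; case: (phi (x * y)%g i j) => c d /=.
- by rewrite lerDl sqr_ge0.
- by rewrite lerDr sqr_ge0.
Qed.

Hypothesis tbN : tb_filter N.
Let filtN : Filter N := tbf_filter tbN.
#[local] Existing Instance filtN.

Lemma ucont_defect n (phi : G -> 'M[C]_n) : rep_n phi -> rep_continuous phi ->
  ucont N (defect phi).
Proof.
move=> phir phic; rewrite (_ : defect phi =
    fun x => 2 * n%:R - 2 * \sum_i complex.Re (phi x i i)).
  apply: ucontB => //; first exact: ucont_cst.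
  apply: ucontZ => //; apply: ucont_sum => // i.
  by case: (ucont_entry i i phir phic).
by apply/funext => x; rewrite defect_tr// Re_sum.
Qed.

(* Peter-Weyl in neighborhood form. *)
Lemma nbhs_rep U : N U -> exists n (phi : G -> 'M[C]_n) e,
  [/\ rep_n phi, rep_continuous phi, 0 < e & forall x, defect phi x < e -> U x].
Proof.
move=> NU; have [n [phi [d [phir d0 phiU]]]] := nbhs_orth_rep R tbN NU.
(* Degree 0 is excluded from [rep_n]. In that case the condition on entries is vacuous, U is all of
   G, and the trivial representation serves. *)
have [n0|n0] := posnP n.
  exists 1%N, (@rep_trivial R G), 1; split=> //; first exact: rep_n_trivial.
    move=> e e0; apply: filterS filterT => x _ /=; rewrite defect_trivial//.
  by move=> x _; apply: phiU => i; exfalso; case: i; rewrite n0.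
have [phiT phiM uphi] := phir.
pose psi x : 'M[C]_n := map_mx (real_complex R) (phi x).
have psiE x : defect psi x = \sum_i \sum_j (phi x i j - (i == j)%:R) ^+ 2.
  apply: eq_bigr => i _; apply: eq_bigr => j _; rewrite /sqc !mxE.
  rewrite -(rmorph_nat (real_complex R)) -rmorphB /=.
  by rewrite expr0n addr0.
exists n, psi, (d ^+ 2); split.
- split=> // [x|x y]; last by rewrite /psi phiM map_mxM.
  apply/unitarymxP; rewrite -[RHS](map_mx1 (real_complex R)) -(phiT x) map_mxM.
  congr (_ *m _); apply/matrixP => i j; rewrite !mxE.
  by apply/eqP; rewrite eq_complex /= oppr0 !eqxx.
- move=> e e0; have e2 : 0 < e / 2 by lra.
  have : ucont N (defect psi).
    rewrite (_ : defect psi = fun x =>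
      \sum_i \sum_j (phi x i j - (i == j)%:R) ^+ 2).
      apply: ucont_sum => // i; apply: ucont_sum => // j;
        apply: ucont_exp => //.
      by apply: ucontB => //; exact: ucont_cst.
    by apply/funext.
  move=> /(_ _ e2)[V NV Vpsi]; apply: filterS NV => v /(Vpsi 1%g v 1%g).
  have psi1 : defect psi 1%g = 0.
    by rewrite /defect /psi (orth_rep1 phir) map_mx1 subrr; apply/eqP;
      rewrite frob_eq0.
  by rewrite !mul1g mulg1 psi1 subr0 ger0_norm ?defect_ge0//=; lra.
- exact: exprn_gt0.
move=> x dx; apply: phiU => i j; rewrite ler_norm_sqr ?(ltW d0)//.
apply: le_trans (ltW dx);
  rewrite psiE (bigD1 i)//= (bigD1 j)//= -addrA lerDl addr_ge0//.
  by apply: sumr_ge0 => *; exact: sqr_ge0.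
by apply: sumr_ge0 => *; apply: sumr_ge0 => *; exact: sqr_ge0.
Qed.

End ContinuousRepresentations.

(** * The neighborhoods of 1 in a totally bounded group *)

Section TopologicalGroup.
Variables (G : groupType) (t : topology_on G).
Hypothesis tgrp : group_topology t.
Local Notation T := (topologized t).
Implicit Types x y : T.

Lemma nbhs_mul x y (U : set T) : nbhs (x * y)%g U ->
  exists A B : set T, [/\ nbhs x A, nbhs y B & forall u v,
    A u -> B v -> U (u * v)%g].
Proof.
move=> Uxy; have [mulc _] := tgrp.
have [[A B] /= [Ax By] AB] := mulc (x, y) U Uxy.
by exists A, B; split=> // u v Au Bv; exact: (AB (u, v)).
Qed.

Lemma nbhs_mull (a : T) x (U : set T) : nbhs (a * x)%g U -> nbhs x [set z | U
  (a * z)%g].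
Proof.
move=> /nbhs_mul[A [B [Aa Bx AB]]]; apply: filterS Bx => z Bz.
by apply: AB => //; exact: nbhs_singleton.
Qed.

Lemma nbhs_mulr (b : T) x (U : set T) : nbhs (x * b)%g U -> nbhs x [set z | U
  (z * b)%g].
Proof.
move=> /nbhs_mul[A [B [Ax Bb AB]]]; apply: filterS Ax => z Az.
by apply: AB => //; exact: nbhs_singleton.
Qed.

Lemma nbhs_inv x (U : set T) : nbhs x^-1%g U -> nbhs x [set z | U z^-1%g].
Proof. by have [_ invc] := tgrp; exact: invc. Qed.

Lemma nbhs_tb_filter : totally_bounded_topology t -> tb_filter (nbhs (1%g : T)).
Proof.
move=> tb.
have mul1 V : nbhs (1%g : T) V -> exists2 W, nbhs (1%g : T) W &
    forall x y, W x -> W y -> V (x * y)%g.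
  rewrite -{1}[1%g : T]mulg1 => /nbhs_mul[A [B [A1 B1 AB]]].
  by exists (A `&` B); [exact: filterI|move=> x y [Ax _] [_ By]; exact: AB].
have inv1 V : nbhs (1%g : T) V -> nbhs (1%g : T) [set x | V x^-1%g].
  by move=> V1; apply: nbhs_inv; rewrite invg1.
have cover V : nbhs (1%g : T) V ->
    exists F : seq G, forall x : G, exists2 s, s \in F & V (s^-1 * x)%g.
  move=> /tb[F [/finite_seqP[s ->] FV]]; exists s => x.
  have : [set: T] x by [].
  rewrite -FV => -[y ys [z Vz <-]]; exists y => //.
  by rewrite mulKg.
split=> //.
- exact: nbhs_filter.
- by move=> V /nbhs_singleton.
(* Write x^-1 = s u with s in a finite set and u small. Conjugations by the finitely many s are
   handled by a finite intersection, and the factors u^-1 and u are absorbed in passing from W' to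
   V. *)
- move=> V V1; have [W W1 WV] := mul1 _ V1; have [W' W'1 W'W] := mul1 _ W1.
  have W01 : nbhs (1%g : T) (W' `&` [set x | W' x^-1%g] `&` W).
    by apply: filterI; [apply: filterI => //; exact: inv1|].
  have [F FW] := cover _ W01.
  exists [set y | forall s, s \in F -> W' (s^-1 * y * s)%g].
    elim: F {FW} => [|s F IH]; first by apply: filterS filterT => y _ s.
    have W's : nbhs (s : T) [set z : T | W' (s^-1 * z)%g].
      by apply: (@nbhs_mull (s^-1)%g s W'); rewrite mulVg.
    have Ws : nbhs (1%g : T) [set z : T | W' (s^-1 * (z * s))%g].
      by apply: (@nbhs_mulr s 1%g [set z : T | W' (s^-1 * z)%g]); rewrite mul1g.
    apply: filterS2 Ws IH => y ys yF u.
    by rewrite inE => /predU1P[->|/yF]; rewrite -?mulgA.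
  move=> x y yF; have [s sF [[W'u W'iu] Wu]] := FW x^-1%g.
  set u := (s^-1 * x^-1)%g in W'u W'iu Wu.
  have -> : (x * y * x^-1)%g = (u^-1 * (s^-1 * y * s) * u)%g.
    by rewrite /u invgM !invgK -!mulgA !mulVKg.
  by apply: WV => //; apply: W'W => //; exact: yF.
Qed.

End TopologicalGroup.

(** * The topology of a representation space *)

Section RepresentationsOfTopology.
Variables (R : realType) (G : groupType).
Local Notation C := R[i].

Definition continuous_reps (t : topology_on G) : set (matrix_map R G) :=
  [set u | rep u /\ rep_continuous (nbhs (1%g : topologized t)) (projT2 u)].

Lemma continuous_reps_space (t : topology_on G) :
  hausdorff_tb_group_topologies G t -> representation_space (continuous_reps t).
Proof.
move=> [tgrp haus tb]; have tbN := nbhs_tb_filter tgrp tb.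
set N := nbhs _ in tbN; have filtN : Filter N := tbf_filter tbN.
split.
- by move=> u [].
- move=> x x1; have [U NU nUx] : exists2 U, N U & ~ U x.
    apply: contrapT => NUx; apply: x1; symmetry; apply: haus => A B NA NB.
    exists x; split; last exact: nbhs_singleton NB.
    by apply: contrapT => nAx; apply: NUx; exists A.
  have [n [phi [e [phir phic e0 phiU]]]] := nbhs_rep R tbN NU.
  exists n, phi; split=> // phix1; apply/nUx/phiU.
  by rewrite /defect phix1 subrr frob0.
- move=> n m phi psi [phir phic] [psir psic]; split; first exact: rep_n_sum.
  move=> e e0; have e2 : 0 < e / 2 by lra.
  apply: filterS2 (phic _ e2) (psic _ e2) => x /= ? ?.
  by rewrite defect_sum; lra.
- move=> n m phi psi [phir phic] [psir psic]; split; first exact: rep_n_tensor.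
  move=> e e0; have [n0 _ _] := phir; have [m0 _ _] := psir.
  have n1 : 0 < 4 * n%:R :> R by rewrite mulr_gt0// ltr0n.
  have m1 : 0 < 4 * m%:R :> R by rewrite mulr_gt0// ltr0n.
  apply: filterS2 (phic _ (divr_gt0 e0 m1)) (psic _ (divr_gt0 e0 n1)) => x /=.
  rewrite !ltr_pdivlMr// => ? ?;
    apply: le_lt_trans (defect_tensor_le phir psir x) _.
  by lra.
- move=> n phi [phir phic]; split; first exact: rep_n_conj.
  by move=> e /phic; apply: filterS => x /=; rewrite defect_conj.
- move=> n phi A [phir phic] uA; split; first exact: rep_n_similar.
  by move=> e /phic; apply: filterS => x /=; rewrite defect_similar.
- move=> m p phi phir [_ phic] j; split; first exact: phir.
  move=> e /phic; apply: filterS => x /=; apply: le_lt_trans.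
  exact: defect_summand.
- split; first exact: rep_n_trivial.
  by move=> e e0; apply: filterS filterT => x _ /=; rewrite defect_trivial.
Qed.

(* Pigeonhole on a grid of matrices. *)
Lemma defect_cover n (phi : G -> 'M[C]_n) e : rep_n phi -> 0 < e ->
  exists F : seq G, forall x, exists2 s, s \in F & defect phi (s^-1 * x)%g < e.
Proof.
move=> phir e0; have [n0 phiU _] := phir.
have n1 : 1 <= n%:R :> R by rewrite ler1n.
pose part (b : bool) (z : C) : R := if b then complex.Re z else complex.Im z.
have part_bound b x i j : `|part b (phi x i j)| <= n%:R.
  rewrite ler_norm_sqr//; apply: (@le_trans _ _ (sqc (phi x i j))).
    by rewrite /part /sqc; case: b; rewrite ?lerDl ?lerDr sqr_ge0.
  rewrite (le_trans (sqc_le_frob _ _ _))// (frob_unitary (phiU x)) expr2.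
  by rewrite ler_peMr.
(* In a grid of mesh 1 / K, elements of one cell differ by at most 1 / K in each of the 2 n^2 real
   coordinates, hence by at most 2 n^2 / K^2 in squared norm. *)
pose K := (Num.bound (2 * n%:R ^+ 2 / e)).+1.
have K1 : 1 <= K%:R :> R by rewrite ler1n.
have Ke : 2 * n%:R ^+ 2 / K%:R ^+ 2 < e.
  rewrite ltr_pdivrMr; last by rewrite exprn_gt0//; lra.
  rewrite [ltRHS]mulrC -ltr_pdivrMr//.
  have : 2 * n%:R ^+ 2 / e < (Num.bound (2 * n%:R ^+ 2 / e))%:R :> R.
    by apply: archi_boundP; rewrite divr_ge0 ?(ltW e0)// mulr_ge0 ?sqr_ge0.
  move/lt_le_trans; apply; apply: (@le_trans _ _ K%:R);
    first by rewrite ler_nat.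
  by rewrite expr2 ler_peMr//; lra.
(* Coordinates lie in [- n, n]; the shift by n makes the argument of [truncn] nonnegative, as needed
   for the truncation to be a floor. *)
pose grid b x i j := Num.truncn ((part b (phi x i j) + n%:R) * K%:R).
have grid_lt b x i j : (grid b x i j < (2 * n * K).+1)%N.
  rewrite ltnS -(ler_nat R); have := part_bound b x i j.
  rewrite ler_norml => /andP[lo hi].
  apply: (@le_trans _ _ ((part b (phi x i j) + n%:R) * K%:R)).
    by rewrite truncn_le; apply: mulr_ge0 => //; lra.
  by rewrite !natrM ler_wpM2r//; lra.
pose cell x : {ffun bool * 'I_n * 'I_n -> 'I_(2 * n * K).+1} :=
  [ffun u => Ordinal (grid_lt u.1.1 x u.1.2 u.2)].
(* One chosen element in each nonempty cell. *)
pose F := pmap (fun c => if pselect (exists x, cell x = c) is left ex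
                         then Some (projT1 (cid ex)) else None)
  (enum {: {ffun bool * 'I_n * 'I_n -> 'I_(2 * n * K).+1}}).
exists F => x.
have ex : exists y, cell y = cell x by exists x.
have [s sF sx] : exists2 s, s \in F & cell s = cell x.
  case: (pselect (exists y, cell y = cell x)) => // ex'.
  exists (projT1 (cid ex')); last by case: cid.
  rewrite mem_pmap; apply/mapP; exists (cell x); first by rewrite mem_enum.
  by case: pselect => // ex''; rewrite (Prop_irrelevance ex' ex'').
exists s => //; rewrite -(defect_dist s _ 1%g phir) !mulg1 mulVKg.
apply: le_lt_trans Ke.
have close b i j : (part b (phi x i j) - part b (phi s i j)) ^+ 2 <= K%:R^-2.
  have /ffunP/(_ (b, i, j)) := sx; rewrite !ffunE => /(congr1 val)/= g.
  rewrite -[K%:R^-2]exprVn -ler_norm_sqr ?invr_ge0//.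
  rewrite -[K%:R^-1]mul1r ler_pdivlMr; last by lra.
  rewrite -[X in _ * X <= _](@ger0_norm _ K%:R)// -normrM mulrBl.
  have bnd y : (grid b y i j)%:R <= (part b (phi y i j) + n%:R) * K%:R < (grid
    b y i j).+1%:R.
    by apply: truncn_itv; rewrite mulr_ge0//; have := part_bound b y i j;
      rewrite ler_norml; lra.
  have := bnd x; have := bnd s; rewrite g -!natr1 ler_norml.
  by move=> /andP[? ?] /andP[? ?]; apply/andP; split; lra.
have -> : 2 * n%:R ^+ 2 / K%:R ^+ 2 = \sum_(i < n) \sum_(j < n) (2 / K%:R ^+ 2)
  :> R.
  by rewrite !sumr_const card_ord -mulrnA -[RHS]mulr_natr natrM; ring.
apply: ler_sum => i _; apply: ler_sum => j _; rewrite !mxE.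
have := close true i j; have := close false i j; rewrite /sqc /part.
case: (phi x i j) => a b; case: (phi s i j) => c d /=; lra.
Qed.

Variable Gamma : set (matrix_map R G).
Hypothesis rsGamma : representation_space Gamma.

(** A single member of Gamma defines a basic neighborhood: finite intersections are covered by
    direct sums, on which [defect] is additive. *)
Definition rep_opens : set (set G) := [set O | forall x, O x ->
  exists n (phi : G -> 'M[C]_n) e, [/\ degree_part Gamma phi, 0 < e &
    forall y, defect phi (x^-1 * y)%g < e -> O y]].

Let Gamma_rep n (phi : G -> 'M[C]_n) : degree_part Gamma phi -> rep_n phi.
Proof. by move=> /(rspace_sub rsGamma). Qed.

Lemma rep_opensT : rep_opens setT.
Proof. by move=> x _; exists 1%N, (@rep_trivial R G), 1; split=> //;
  case: rsGamma. Qed.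

Lemma rep_opensI : setI_closed rep_opens.
Proof.
move=> A B Aop Bop x [/Aop[n [phi [d [phiG d0 phiA]]]] /Bop[m [psi [e [psiG e0
  psiB]]]]].
exists (n + m)%N, (rep_sum phi psi), (Num.min d e); split.
- exact: rspace_sum.
- by rewrite lt_min d0.
move=> y; rewrite defect_sum lt_min => /andP[yd ye].
have := defect_ge0 phi (x^-1 * y)%g; have := defect_ge0 psi (x^-1 * y)%g.
by split; [apply: phiA|apply: psiB]; lra.
Qed.

Lemma rep_opens_bigcup S : S `<=` rep_opens -> rep_opens (\bigcup_(A in S) A).
Proof.
move=> Sop x [A SA /(Sop _ SA)[n [phi [e [phiG e0 phiA]]]]].
by exists n, phi, e; split=> // y /phiA Ay; exists A.
Qed.

Definition rep_topology := TopologyOn rep_opensT rep_opensI rep_opens_bigcup.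
Local Notation T := (topologized rep_topology).

Lemma nbhs_rep_topology (x : T) (U : set T) : nbhs x U <->
  exists n (phi : G -> 'M[C]_n) e, [/\ degree_part Gamma phi, 0 < e &
    forall y : G, defect phi ((x : G)^-1 * y)%g < e -> U y].
Proof.
rewrite nbhsE; split=> [[O [Oop Ox] OU]|[n [phi [e [phiG e0 phiU]]]]].
  have [n [phi [e [phiG e0 phiO]]]] := Oop x Ox.
  by exists n, phi, e; split=> // y /phiO/OU.
(* The points having some ball inside U. This set is open because a quarter of the radius
   compensates for the factor 2 in [defectM_le]. *)
exists [set z : T | exists2 d, 0 < d &
  forall y : G, defect phi ((z : G)^-1 * y)%g < d -> U y].
  split; last by exists e.
  move=> z [d d0 zU]; exists n, phi, (d / 4); split=> // [|w zw]; first by lra.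
  exists (d / 4) => [|y wy]; first by lra.
  apply: zU; have := defectM_le (z^-1 * w)%g (w^-1 * y)%g (Gamma_rep phiG).
  by rewrite mulgA mulgK; lra.
move=> z [d d0]; apply; rewrite mulVg defect1//; exact: Gamma_rep.
Qed.

Lemma rep_topology_group : group_topology rep_topology.
Proof.
split.
- move=> [x y] U /nbhs_rep_topology[n [phi [e [phiG e0 phiU]]]].
  have phir := Gamma_rep phiG; have e4 : 0 < e / 4 by lra.
  exists ([set u : T | defect phi ((x : G)^-1 * u)%g < e / 4],
          [set u : T | defect phi ((y : G)^-1 * u)%g < e / 4]).
    by split; apply/nbhs_rep_topology; exists n, phi, (e / 4).
  move=> [u v] /= [xu yv]; apply: phiU => /=.
  have -> : ((x * y)^-1 * (u * v) = (y^-1 * (x^-1 * u) * y^-1^-1) * (y^-1 *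
    v))%g.
    by rewrite invgK invgM -!mulgA mulVKg.
  have := defectM_le (y^-1 * (x^-1 * u) * y^-1^-1)%g (y^-1 * v)%g phir.
  by rewrite defect_conjg//; lra.
- move=> x U /nbhs_rep_topology[n [phi [e [phiG e0 phiU]]]].
  have phir := Gamma_rep phiG.
  apply/nbhs_rep_topology; exists n, phi, e; split=> // y xy; apply: phiU.
  have -> : (x^-1^-1 * y^-1 = x * (x^-1 * y)^-1 * x^-1)%g.
    by rewrite !invgM !invgK !mulgA mulgK.
  by rewrite defect_conjg// defectV.
Qed.

Lemma rep_topology_hausdorff : hausdorff_space T.
Proof.
move=> x y xy; apply: contrapT => nxy.
have /(rspace_separates rsGamma)[n [phi [phiG phi1]]] : ((x : G)^-1 * y)%g <>
  1%g.
  by move=> xy1; apply: nxy; rewrite -[LHS]mulg1 -xy1 mulVKg.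
have phir := Gamma_rep phiG.
have d0 : 0 < defect phi (x^-1 * y)%g.
  by rewrite lt0r defect_ge0 andbT frob_eq0 subr_eq0; exact/eqP.
have d4 : 0 < defect phi (x^-1 * y)%g / 4 by lra.
have [||z [/= xz yz]] :=
  xy [set z : T | defect phi ((x : G)^-1 * z)%g < defect phi (x^-1 * y)%g / 4]
  [set z : T | defect phi ((y : G)^-1 * z)%g < defect phi (x^-1 * y)%g / 4].
- by apply/nbhs_rep_topology; exists n, phi, (defect phi (x^-1 * y)%g / 4).
- by apply/nbhs_rep_topology; exists n, phi, (defect phi (x^-1 * y)%g / 4).
have := defectM_le (x^-1 * z)%g (z^-1 * y)%g phir.
rewrite -(defectV (z^-1 * y)%g phir) invgM invgK mulgA mulgK.
by lra.
Qed.

Lemma rep_topology_tb : totally_bounded_topology rep_topology.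
Proof.
move=> U /nbhs_rep_topology[n [phi [e [phiG e0 phiU]]]].
have [F Fcover] := defect_cover (Gamma_rep phiG) e0.
exists [set` F]; split; first exact: finite_seq.
rewrite -subTset => x _; have [s sF sx] := Fcover x.
exists s => //; exists (s^-1 * x)%g; last by rewrite mulVKg.
by apply: phiU; rewrite invg1 mul1g.
Qed.

Lemma rep_topology_htb : hausdorff_tb_group_topologies G rep_topology.
Proof.
split.
- exact: rep_topology_group.
- exact: rep_topology_hausdorff.
- exact: rep_topology_tb.
Qed.

End RepresentationsOfTopology.

(** * Subrepresentations *)

Section SubRepresentations.
Variables (R : realType) (G : groupType).
Local Notation C := R[i].
Local Open Scope sesquilinear_scope.

Lemma adj_mul m n p (A : 'M[C]_(m, n)) (B : 'M[C]_(n, p)) :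
  (A *m B)^t* = B^t* *m A^t*.
Proof. by rewrite trmx_mul map_mxM. Qed.

Lemma adj_mx0 m n : (0 : 'M[C]_(m, n))^t* = 0.
Proof. by rewrite trmx0 map_mx0. Qed.

Lemma unitary_complement d D (V : 'M[C]_(d, D)) : V \is unitarymx ->
  exists e (W : 'M[C]_(e, D)), [/\ (d + e)%N = D,
    W \is unitarymx & W *m V^t* = 0].
Proof.
move=> uV; pose K := kermx (V^t*).
have rV : \rank (V^t*) = d by rewrite mxrank_map mxrank_tr mxrank_unitary.
have dD : (d <= D)%N by rewrite -[d](mxrank_unitary uV) rank_leq_col.
exists (\rank K), (schmidt (row_base K)); split.
- by rewrite mxrank_ker rV subnKC.
- by rewrite schmidt_unitarymx// rank_leq_row.
- by apply/sub_kermxP; rewrite eqmx_schmidt_free ?eq_row_base// row_base_free.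
Qed.

Lemma unitary_complete d e D (V : 'M[C]_(d, D)) (W : 'M[C]_(e, D)) :
  (d + e)%N = D -> V \is unitarymx -> W \is unitarymx -> W *m V^t* = 0 ->
  V^t* *m V + W^t* *m W = 1%:M.
Proof.
move=> eD; case: _ / eD in V W * => /unitarymxP uV /unitarymxP uW WV.
have VW : V *m W^t* = 0 by rewrite -[LHS]trmxCK adj_mul trmxCK WV adj_mx0.
have : col_mx V W \is unitarymx.
  apply/unitarymxP; rewrite tr_col_mx map_row_mx mul_col_row uV uW WV VW.
  by rewrite -scalar_mx_block.
move=> /unitarymxP/mulmx1C; rewrite tr_col_mx map_row_mx mul_row_col.
by [].
Qed.

Section Complement.
Variables (d e D : nat) (Theta : G -> 'M[C]_D) (rho : G -> 'M[C]_d).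
Variables (V : 'M[C]_(d, D)) (W : 'M[C]_(e, D)).
Hypotheses (Thetar : rep_n Theta) (eD : (d + e)%N = D).
Hypotheses (uV : V \is unitarymx) (uW : W \is unitarymx) (WV : W *m V^t* = 0).
Hypothesis intV : forall x, V *m Theta x = rho x *m V.

Definition complement_rep x := W *m Theta x *m W^t*.

(** [Theta x] is the adjoint of [Theta x^-1], so invariance of the row space of V passes to its
    orthogonal complement. *)
Let WThetaV x : W *m Theta x *m V^t* = 0.
Proof.
rewrite -[Theta x]trmxCK -(rep_nV _ Thetar) -mulmxA -adj_mul intV adj_mul.
by rewrite mulmxA WV mul0mx.
Qed.

Lemma complement_repE x : W *m Theta x = complement_rep x *m W.
Proof.
rewrite /complement_rep -[LHS]mulmx1 -(unitary_complete eD uV uW WV) mulmxDr.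
by rewrite !mulmxA WThetaV mul0mx add0r.
Qed.

Lemma rep_n_complement : (0 < e)%N -> rep_n complement_rep.
Proof.
have [_ ThetaU ThetaM] := Thetar; split=> // [x|x y].
  apply/unitarymxP; rewrite {2}/complement_rep !adj_mul trmxCK mulmxA
    -complement_repE.
  rewrite -!mulmxA (mulmxA (Theta x)) (unitarymxP (ThetaU x)) mul1mx.
  exact/unitarymxP.
rewrite {3}/complement_rep !mulmxA -complement_repE /complement_rep ThetaM.
by rewrite !mulmxA.
Qed.
End Complement.

Lemma rep_n_sub d D (Theta : G -> 'M[C]_D) (rho : G -> 'M[C]_d) (V : 'M[C]_(d,
  D)) :
  rep_n Theta -> (0 < d)%N -> V \is unitarymx ->
  (forall x, V *m Theta x = rho x *m V) -> rep_n rho.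
Proof.
move=> [_ ThetaU ThetaM] d0 uV intV.
have rhoE x : rho x = V *m Theta x *m V^t*.
  by rewrite intV -mulmxA (unitarymxP uV) mulmx1.
split=> // [x|x y].
  apply/unitarymxP; rewrite {2}rhoE !adj_mul trmxCK mulmxA -intV.
  rewrite -!mulmxA (mulmxA (Theta x)) (unitarymxP (ThetaU x)) mul1mx.
  exact/unitarymxP.
by rewrite (rhoE y) !mulmxA -intV rhoE ThetaM !mulmxA.
Qed.

Lemma rep_sum_complement d e (Theta : G -> 'M[C]_(d + e)) (rho : G -> 'M[C]_d)
    (V : 'M[C]_(d, d + e)) (W : 'M[C]_(e, d + e)) :
  rep_n Theta -> V \is unitarymx -> W \is unitarymx -> W *m V^t* = 0 ->
  (forall x, V *m Theta x = rho x *m V) ->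
  col_mx V W \is unitarymx /\
  Theta = rep_similar (col_mx V W) (rep_sum rho (complement_rep Theta W)).
Proof.
move=> Thetar uV uW WV intV.
have uVW : col_mx V W \is unitarymx.
  apply/unitarymxP/mulmx1C; rewrite tr_col_mx map_row_mx mul_row_col.
  exact: unitary_complete.
split=> //; apply/funext => x; rewrite /rep_similar /rep_sum -mulmxA.
rewrite mul_block_col !mul0mx addr0 add0r -intV -(complement_repE Thetar _ uV
  uW WV intV)//.
by rewrite -mul_col_mx mulKmx// unitarymx_unit.
Qed.

Variable Gamma : set (matrix_map R G).
Hypothesis rsGamma : representation_space Gamma.

Let Gamma_rep n (phi : G -> 'M[C]_n) : degree_part Gamma phi -> rep_n phi.
Proof. by move=> /(rspace_sub rsGamma). Qed.

(** Stacking the V j gives a square unitary matrix that conjugates Theta into the block-diagonal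
    form to which [rspace_summand] applies. *)
Lemma rspace_orthogonal_family D (Theta : G -> 'M[C]_D) m (p : 'I_m -> nat)
    (phi : forall j, G -> 'M[C]_(p j)) (V : forall j, 'M[C]_(p j, D)) :
  degree_part Gamma Theta -> (\sum_j p j)%N = D -> (forall j, rep_n (phi j)) ->
  (forall j, V j \is unitarymx) -> (forall i j,
    i != j -> V i *m (V j)^t* = 0) ->
  (forall j x, V j *m Theta x = phi j x *m V j) ->
  forall j, degree_part Gamma (phi j).
Proof.
move=> ThetaG pD phir uV VV intV; case: _ / pD in Theta V ThetaG uV VV intV *.
pose M := \mxcol_j V j.
have uM : M \is unitarymx.
  apply/unitarymxP; have -> : M^t* = \mxrow_j (V j)^t*.
    by rewrite tr_mxcol; apply/matrixP => a b; rewrite !mxE.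
  rewrite mul_mxcol_mxrow -mxdiagZ; apply/eq_mxblockP => i j.
  case: eqVneq => [->|/VV//]; by rewrite conform_mx_id; exact/unitarymxP.
apply: (rspace_summand rsGamma phir).
have -> : rep_bigsum phi = rep_similar (M^t*) Theta.
  apply/funext => x; rewrite /rep_similar invmx_unitary ?trmxC_unitary// trmxCK.
  have -> : M *m Theta x = rep_bigsum phi x *m M.
    rewrite /M mul_mxdiag_mxcol mxcol_mul; apply/eq_mxcol => j.
    by rewrite intV.
  by rewrite -mulmxA (unitarymxP uM) mulmx1.
by apply: (rspace_similar rsGamma ThetaG); rewrite trmxC_unitary.
Qed.

Lemma rspace_subrep d D (Theta : G -> 'M[C]_D) (rho : G -> 'M[C]_d)
    (V : 'M[C]_(d, D)) : degree_part Gamma Theta -> (0 < d)%N ->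
  V \is unitarymx -> (forall x, V *m Theta x = rho x *m V) ->
  degree_part Gamma rho.
Proof.
move=> ThetaG d0 uV intV; have Thetar := Gamma_rep ThetaG.
have rhor := rep_n_sub Thetar d0 uV intV.
have [e [W [eD uW WV]]] := unitary_complement uV.
(* A complement of degree 0 is not in [rep_n], so V then forms a family by itself. *)
have [e0|e0] := posnP e.
  have := @rspace_orthogonal_family D Theta 1 (fun=> d) (fun=> rho) (fun=> V)
    ThetaG.
  apply=> //; last exact: ord0.
    by rewrite big_ord1 -eD e0 addn0.
  by move=> i j; rewrite !ord1.
pose p (j : 'I_2) := if val j is 0 then d else e.
pose phi (j : 'I_2) : G -> 'M[C]_(p j) :=
  match val j as k return G -> 'M[C]_(if k is 0 then d else e) with
  | 0 => rho | _.+1 => complement_rep Theta W end.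
pose VW (j : 'I_2) : 'M[C]_(p j, D) :=
  match val j as k return 'M[C]_(if k is 0 then d else e, D) with
  | 0 => V | _.+1 => W end.
have := @rspace_orthogonal_family D Theta 2 p phi VW ThetaG.
have VW0 : V *m W^t* = 0 by rewrite -[LHS]trmxCK adj_mul trmxCK WV adj_mx0.
move=> H; apply: (H _ _ _ _ _ ord0).
- by rewrite big_ord_recl big_ord1.
- case=> [[|[|//]] /= lti]; first exact: rhor.
  exact: (rep_n_complement Thetar eD uV uW WV intV e0).
- by case=> [[|[|//]] /= lti].
- by case=> [[|[|//]] /= lti] [[|[|//]] /= ltj].
- case=> [[|[|//]] /= lti] x; first exact: intV.
  exact: (complement_repE Thetar eD uV uW WV intV).
Qed.

(** H, the adjoint of B times B, commutes with phi; an eigenspace of H is invariant and nonzero,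
    hence everything, and H is a scalar. Its trace shows that the scalar is |B|^2 / d > 0, so a real
    multiple of the adjoint of B has orthonormal rows. *)
Lemma schur_embedding d D (Theta : G -> 'M[C]_D) (phi : G -> 'M[C]_d) (B :
  'M[C]_(D, d)) :
  rep_n Theta -> rep_n phi -> B != 0 -> (forall x, Theta x *m B = B *m phi x) ->
  (forall U : 'M[C]_d, (forall x,
    (U *m phi x <= U)%MS) -> U != 0 -> \rank U = d) ->
  exists2 V : 'M[C]_(d, D), V \is unitarymx & forall x,
    V *m Theta x = phi x *m V.
Proof.
move=> Thetar phir B0 intB irr; have [d0 _ _] := phir.
have intB' x : B^t* *m Theta x = phi x *m B^t*.
  rewrite -[Theta x]trmxCK -(rep_nV _ Thetar) -adj_mul intB adj_mul (rep_nV _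
    phir).
  by rewrite trmxCK.
pose H := B^t* *m B.
have Hphi x : phi x *m H = H *m phi x.
  by rewrite /H mulmxA -intB' -!mulmxA intB.
have [a ea] := eigenvalue_closed H d0.
have HE : H = a%:M.
  have rU : \rank (eigenspace H a) = d.
    apply: irr ea => x; apply/eigenspaceP; rewrite -mulmxA Hphi mulmxA.
    by rewrite (eigenspaceP (submx_refl (eigenspace H a))) -scalemxAl.
  have : (1%:M <= eigenspace H a)%MS by rewrite sub1mx /row_full rU.
  by move=> /eigenspaceP; rewrite mul1mx scalemx1.
have dn0 : d%:R != 0 :> R by rewrite pnatr_eq0 -lt0n.
have aE : a = (frob B / d%:R)%:C%C.
  have : \tr H = (frob B)%:C%C by rewrite frobE mxtrace_mulC.
  rewrite HE mxtrace_scalar rmorphM fmorphV rmorph_nat /= => <-.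
  by rewrite -(mulr_natr a) mulfK// pnatr_eq0 -lt0n.
have r0 : 0 < frob B / d%:R.
  by rewrite divr_gt0 ?ltr0n// lt0r frob_ge0 frob_eq0 B0.
pose c := ((Num.sqrt (frob B / d%:R))^-1)%:C%C : C.
exists (c *: B^t*) => [|x]; last by rewrite -scalemxAl -scalemxAr intB'.
apply/unitarymxP; rewrite -scalemxAl linearZ map_mxZ trmxCK -scalemxAr -/H HE.
rewrite !scale_scalar_mx; congr (_%:M); rewrite aE.
rewrite [X in _ * (X * _)](_ : _ = c); last exact: conjc_real.
rewrite -!rmorphM /= mulrA -expr2 exprVn sqr_sqrtr ?ltW// mulVf//.
exact: lt0r_neq0.
Qed.

End SubRepresentations.

(** * Representations continuous for the topology of a representation space *)

Section ComplexMean.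
Variables (R : realType) (G : groupType) (N : set (set G)).
Hypothesis tbN : tb_filter N.
Local Notation C := R[i].
Local Open Scope sesquilinear_scope.
Implicit Types f g : G -> C.

Definition cucont f := ucont N (fun x => complex.Re (f x)) /\
  ucont N (fun x => complex.Im (f x)).

Definition cmean f : C := Complex (mean (fun x => complex.Re (f x)))
  (mean (fun x => complex.Im (f x))).

Lemma Re_mul (a b : C) :
  complex.Re (a * b) = complex.Re a * complex.Re b - complex.Im a * complex.Im
    b.
Proof. by case: a; case: b. Qed.

Lemma Im_mul (a b : C) :
  complex.Im (a * b) = complex.Re a * complex.Im b + complex.Im a * complex.Re
    b.
Proof. by case: a; case: b. Qed.

Lemma Re_add (a b : C) : complex.Re (a + b) = complex.Re a + complex.Re b.
Proof. by case: a; case: b. Qed.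

Lemma Im_add (a b : C) : complex.Im (a + b) = complex.Im a + complex.Im b.
Proof. by case: a; case: b. Qed.

Lemma Re_conj (a : C) : complex.Re a^* = complex.Re a.
Proof. by case: a. Qed.

Lemma Im_conj (a : C) : complex.Im a^* = - complex.Im a.
Proof. by case: a. Qed.

Lemma cucontM f g : cucont f -> cucont g -> cucont (fun x => f x * g x).
Proof.
move=> [f1 f2] [g1 g2]; split.
  by rewrite (funext (fun x => Re_mul (f x) (g x))); apply: (ucontB tbN);
    exact: (ucontM tbN).
by rewrite (funext (fun x => Im_mul (f x) (g x))); apply: (ucontD tbN);
  exact: (ucontM tbN).
Qed.

Lemma cucont_conj f : cucont f -> cucont (fun x => (f x)^*).
Proof.
move=> [f1 f2]; split; first by rewrite (funext (fun x => Re_conj (f x))).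
by rewrite (funext (fun x => Im_conj (f x))); exact: ucontN.
Qed.

Lemma cucont_cst c : cucont (fun=> c).
Proof. by split; exact: ucont_cst. Qed.

Lemma cucontD f g : cucont f -> cucont g -> cucont (fun x => f x + g x).
Proof.
move=> [f1 f2] [g1 g2]; split.
  by rewrite (funext (fun x => Re_add (f x) (g x))); exact: (ucontD tbN).
by rewrite (funext (fun x => Im_add (f x) (g x))); exact: (ucontD tbN).
Qed.

Lemma cmeanD f g : cucont f -> cucont g ->
  cmean (fun x => f x + g x) = cmean f + cmean g.
Proof.
move=> [f1 f2] [g1 g2]; rewrite /cmean.
rewrite (funext (fun x => Re_add (f x) (g x))) (funext (fun x =>
  Im_add (f x) (g x))).
by rewrite !(meanD tbN).
Qed.

Lemma cmeanZ c f : cucont f -> cmean (fun x => c * f x) = c * cmean f.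
Proof.
move=> [f1 f2]; rewrite /cmean.
rewrite (funext (fun x => Re_mul c (f x))) (funext (fun x => Im_mul c (f x))).
rewrite (meanB tbN) ?(meanD tbN) ?(meanZ tbN)//; try exact: ucontZ.
by case: c.
Qed.

Lemma cmean_cst c : cmean (fun=> c) = c.
Proof. by rewrite /cmean !(mean_cst tbN); case: c. Qed.

Lemma cmean_sum I (r : seq I) (F : I -> G -> C) : (forall i, cucont (F i)) ->
  cmean (fun x => \sum_(i <- r) F i x) = \sum_(i <- r) cmean (F i) /\
  cucont (fun x => \sum_(i <- r) F i x).
Proof.
move=> uF; elim: r => [|i r [IH uIH]].
  rewrite (_ : (fun x => _) = fun=> 0); last by apply/funext => x;
    rewrite big_nil.
  by split; [rewrite cmean_cst big_nil|exact: cucont_cst].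
rewrite (_ : (fun x => _) = fun x => F i x + \sum_(j <- r) F j x); last first.
  by apply/funext => x; rewrite big_cons.
by split; [rewrite cmeanD// IH big_cons|exact: cucontD].
Qed.

Lemma cmean_mull f a : cucont f -> cmean (fun x => f (a * x)%g) = cmean f.
Proof.
by move=> [f1 f2]; congr Complex;
  [rewrite -(mean_mull tbN a f1)|rewrite -(mean_mull tbN a f2)].
Qed.

Lemma cucont_entry n (phi : G -> 'M[C]_n) i j : rep_n phi ->
  rep_continuous N phi -> cucont (fun x => phi x i j).
Proof. by move=> phir phic; exact: ucont_entry. Qed.

(** For each elementary matrix E the mean of Theta(x) E phi(x^-1) intertwines, by invariance; these
    are the [B a b]. Were they all zero, summing the (i, j) entries of the [B i j] would give a zero
    mean for the product of characters. *)
Lemma intertwiner D d (Theta : G -> 'M[C]_D) (phi : G -> 'M[C]_d) :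
  rep_n Theta -> rep_continuous N Theta -> rep_n phi -> rep_continuous N phi ->
  cmean (fun x => \tr (Theta x) * (\tr (phi x))^*) != 0 ->
  exists2 B : 'M[C]_(D, d), B != 0 & forall x, Theta x *m B = B *m phi x.
Proof.
move=> Thetar Thetac phir phic mean0.
pose f i a j b (x : G) : C := Theta x i a * (phi x j b)^*.
have uf i a j b : cucont (f i a j b).
  by apply: cucontM; [|apply: cucont_conj]; exact: cucont_entry.
pose B a b : 'M[C]_(D, d) := \matrix_(i, j) cmean (f i a j b).
have intB a b (z : G) : Theta z *m B a b = B a b *m phi z.
  have [_ _ ThetaM] := Thetar; have [_ _ phiM] := phir.
  apply/matrixP => i j; rewrite !mxE.
  transitivity (cmean (fun x => Theta (z * x)%g i a * (phi x j b)^*)).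
    rewrite (_ : (fun x => _) = fun x => \sum_k Theta z i k * f k a j b x);
      last first.
      by apply/funext => x; rewrite ThetaM mxE mulr_suml;
        apply: eq_bigr => k _; rewrite mulrA.
    rewrite (cmean_sum _ _).1; last first.
      by move=> k; apply: cucontM => //; exact: cucont_cst.
    by apply: eq_bigr => k _; rewrite mxE cmeanZ.
  transitivity (cmean (fun x => Theta x i a * (phi (z^-1 * x)%g j b)^*)).
    have u : cucont (fun x => Theta x i a * (phi (z^-1 * x)%g j b)^*).
      apply: cucontM; first exact: cucont_entry.
      apply: cucont_conj; have [u1 u2] := cucont_entry j b phir phic.
      by split; [exact: (ucont_mull z^-1%g u1)|exact: (ucont_mull z^-1%g u2)].
    rewrite -(cmean_mull z u); congr cmean; apply/funext => x.
    by rewrite mulKg.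
  rewrite (_ : (fun x => _) = fun x => \sum_k phi z k j * f i a k b x);
    last first.
    apply/funext => x; rewrite phiM mxE rmorph_sum mulr_sumr;
      apply: eq_bigr => k _.
    by rewrite rmorphM /= (rep_nV _ phir) !mxE conjCK mulrCA.
  rewrite (cmean_sum _ _).1; last first.
    by move=> k; apply: cucontM => //; exact: cucont_cst.
  by apply: eq_bigr => k _; rewrite [B _ _ _ _]mxE cmeanZ// mulrC.
apply: contrapT => nB; move: mean0; apply/negP/negPn/eqP.
have B0 a b : B a b = 0.
  by apply: contrapT => /eqP Bab; apply: nB; exists (B a b).
rewrite (_ : (fun x => _) = fun x => \sum_i \sum_j f i i j j x); last first.
  apply/funext => x; rewrite rmorph_sum mulr_suml; apply: eq_bigr => i _.
  by rewrite mulr_sumr.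
have us i := (cmean_sum (index_enum 'I_d) (fun j => uf i i j j)).
rewrite (cmean_sum _ (fun i => (us i).2)).1 big1// => i _.
rewrite (us i).1 big1// => j _.
by have /matrixP/(_ i j) := B0 i j; rewrite !mxE.
Qed.

End ComplexMean.

(** * Representations continuous for the induced topology belong to Gamma *)

Section Duality.
Variables (R : realType) (G : groupType) (Gamma : set (matrix_map R G)).
Hypothesis rsGamma : representation_space Gamma.
Local Notation C := R[i].
Local Notation T := (topologized (rep_topology rsGamma)).
Local Notation N := (nbhs (1%g : T)).
Local Open Scope sesquilinear_scope.

Let tbN : tb_filter N.
Proof.
by apply: nbhs_tb_filter; [exact: rep_topology_group|exact: rep_topology_tb].
Qed.

Let Gamma_rep n (phi : G -> 'M[C]_n) : degree_part Gamma phi -> rep_n phi.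
Proof. by move=> /(rspace_sub rsGamma). Qed.

Lemma rspace_continuous n (phi : G -> 'M[C]_n) : degree_part Gamma phi ->
  rep_continuous N phi.
Proof.
move=> phiG e e0; apply/nbhs_rep_topology; exists n, phi, e; split=> // y.
by rewrite invg1 mul1g.
Qed.

Lemma rspace_add_trivial D (Theta : G -> 'M[C]_D) k : degree_part Gamma Theta ->
  exists D' (Theta' : G -> 'M[C]_D'), degree_part Gamma Theta' /\
    forall x, \tr (Theta' x) = \tr (Theta x) + k%:R.
Proof.
move=> ThetaG; elim: k => [|k [D' [Theta' [ThetaG' trE]]]].
  by exists D, Theta; split=> // x; rewrite addr0.
exists (D' + 1)%N, (rep_sum Theta' (@rep_trivial R G)); split.
  by apply: rspace_sum => //; exact: rspace_trivial.
by move=> x; rewrite mxtrace_block trE mxtrace1 -addrA natr1.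
Qed.

(** By [defect_tr] the base is 2 n + 2 Re tr psi, the character of the sum of psi, its conjugate and
    2 n trivial representations; tensor products give the powers. *)
Lemma rspace_power n (psi : G -> 'M[C]_n) k : degree_part Gamma psi ->
  exists D (Theta : G -> 'M[C]_D), degree_part Gamma Theta /\
    forall x, \tr (Theta x) = ((4 * n%:R - defect psi x) ^+ k)%:C%C.
Proof.
move=> psiG; have psir := Gamma_rep psiG.
have [D1 [Theta1 [Theta1G tr1]]] := rspace_add_trivial (2 * n)
  (rspace_sum rsGamma psiG (rspace_conj rsGamma psiG)).
have {}tr1 x : \tr (Theta1 x) = (4 * n%:R - defect psi x)%:C%C.
  rewrite tr1 mxtrace_block (defect_tr _ psir).
  have -> : \tr (rep_conj psi x) = ((\tr (psi x))^*)%C.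
    by rewrite rmorph_sum; apply: eq_bigr => i _; rewrite mxE.
  rewrite addcJ -(rmorph_nat (real_complex R) (2 * n)) -(rmorph_nat
    (real_complex R) 2).
  by rewrite -rmorphM -rmorphD /= natrM; congr (_%:C)%C; ring.
elim: k => [|k [D [Theta [ThetaG trE]]]].
  exists 1%N, (@rep_trivial R G); split; first exact: rspace_trivial.
  by move=> x; rewrite mxtrace1.
exists (D1 * D)%N, (rep_tensor Theta1 Theta); split; first exact: rspace_tensor.
by move=> x; rewrite mxtrace_tens tr1 trE exprS rmorphM.
Qed.

Lemma expr_dominates (c y z : R) : 0 < c -> 0 <= z -> z < y ->
  exists k, 3 * z ^+ k < c * y ^+ k.
Proof.
move=> c0 z0 zy; have y0 : 0 < y by exact: le_lt_trans zy.
have r1 : `|z / y| < 1.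
  by rewrite ger0_norm ?divr_ge0 ?(ltW y0)// ltr_pdivrMr// mul1r.
have c3 : 0 < c / 3 by lra.
have /cvgrPdist_lt/(_ _ c3)[k _ kP] := cvg_expr r1.
exists k; have := kP k (leqnn k).
rewrite sub0r normrN ger0_norm ?exprn_ge0 ?divr_ge0 ?(ltW y0)// expr_div_n.
by rewrite ltr_pdivrMr ?exprn_gt0//; lra.
Qed.

(* The powers [(4 m - defect psi) ^+ k] concentrate near the kernel of [psi],
   where the character of [phi] has positive real part. *)
Lemma character_mean_gt0 n m (phi : G -> 'M[C]_n) (psi : G -> 'M[C]_m) e :
  rep_n phi -> rep_continuous N phi -> rep_n psi -> rep_continuous N psi ->
  0 < e -> (forall x, defect psi x < e -> defect phi x < n%:R) ->
  exists k, 0 < mean (fun x =>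
    (4 * m%:R - defect psi x) ^+ k * complex.Re (\tr (phi x))).
Proof.
move=> phir phic psir psic e0' near'; have [n0 _ _] := phir;
  have [m0 _ _] := psir.
have {}n0 : 0 < n%:R :> R by rewrite ltr0n.
have {}m0 : 0 < m%:R :> R by rewrite ltr0n.
(* The cap keeps 4 m - d nonnegative, so that its powers are monotone bounds. *)
pose d := Num.min e (4 * m%:R); have d0 : 0 < d by rewrite lt_min e0'; lra.
have near x : defect psi x < d -> defect phi x < n%:R.
  by rewrite lt_min => /andP[/near'].
have dm : d <= 4 * m%:R by rewrite ge_min lexx orbT.
have upsi := ucont_defect tbN psir psic;
  have uphi := ucont_defect tbN phir phic.
(* A tent with value 1 at 1, vanishing where [defect psi] exceeds d / 2. Its mean plays the part of
   the measure of that neighborhood and gives the lower bound [mean_v]. *)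
pose b x := Num.max 0 (1 - 2 / d * defect psi x).
have ub : ucont N b.
  apply: ucont_max0; apply: (ucontB tbN); first exact: ucont_cst.
  exact: (ucontZ tbN).
have b0 : 0 < mean b.
  apply: (mean_gt0 tbN) => // [x|]; first by rewrite le_max lexx.
  by rewrite /b (defect1 psir) mulr0 subr0 lt_max ltr01 orbT.
have [||k kP] := @expr_dominates (mean b) (4 * m%:R - d / 2) (4 * m%:R - d) b0.
- by lra.
- by lra.
exists k; pose v x := 4 * m%:R - defect psi x.
have v0 x : 0 <= v x by have := defect_le x psir; rewrite /v; lra.
have uv : ucont N (fun x => v x ^+ k).
  by apply: (ucont_exp tbN); apply: (ucontB tbN) => //; exact: ucont_cst.
have rE x : complex.Re (\tr (phi x)) = n%:R - 2^-1 * defect phi x.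
  by rewrite defect_tr//; lra.
have ur : ucont N (fun x => complex.Re (\tr (phi x))).
  rewrite (funext rE); apply: (ucontB tbN); first exact: ucont_cst.
  exact: (ucontZ tbN).
have y0 : 0 <= 4 * m%:R - d / 2 by lra.
have mean_v : mean b * (4 * m%:R - d / 2) ^+ k <= mean (fun x => v x ^+ k).
  rewrite mulrC -(meanZ tbN)//; apply: (le_mean tbN) => // [|x];
    first exact: (ucontZ tbN).
  rewrite /b; case: (leP 0 (1 - _)) => bx; last by rewrite mulr0 exprn_ge0.
  have dx := defect_ge0 psi x.
  have d2x : 0 <= 2 / d * defect psi x by rewrite mulr_ge0// divr_ge0// ltW.
  have dx2 : defect psi x <= d / 2.
    have : d / 2 * (2 / d * defect psi x) <= d / 2 * 1 by rewrite ler_wpM2l//;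
      lra.
    by rewrite mulrA (_ : d / 2 * (2 / d) = 1) ?mul1r ?mulr1//; field;
      rewrite gt_eqF.
  apply: (@le_trans _ _ ((4 * m%:R - d / 2) ^+ k)).
    by rewrite ler_piMr ?exprn_ge0//; lra.
  by rewrite lerXn2r ?nnegrE//; rewrite /v; lra.
(* Near the kernel of psi, Re tr phi > n / 2. Elsewhere only Re tr phi >= - n is known, and the
   deficit n / 2 + n = 3 n / 2 is the origin of the factor 3. *)
have pointwise x : n%:R / 2 * (v x ^+ k - 3 * (4 * m%:R - d) ^+ k) <=
    v x ^+ k * complex.Re (\tr (phi x)).
  rewrite rE; have vk : 0 <= v x ^+ k by rewrite exprn_ge0.
  have zk : 0 <= (4 * m%:R - d) ^+ k by rewrite exprn_ge0//; lra.
  have [lt_d|ge_d] := ltP (defect psi x) d.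
    have := near x lt_d; set r := defect phi x => rn.
    set V := v x ^+ k in vk *; set Z := (_ - d) ^+ k in zk *.
    have : 0 <= V * (n%:R - r) by rewrite mulr_ge0//; lra.
    have : 0 <= n%:R * Z by rewrite mulr_ge0// ltW.
    lra.
  have : v x ^+ k <= (4 * m%:R - d) ^+ k.
    by rewrite lerXn2r ?nnegrE//; rewrite /v; lra.
  have := defect_le x phir; set r := defect phi x => rn.
  set V := v x ^+ k in vk *; set Z := (_ - d) ^+ k in zk * => VZ.
  have : 0 <= V * (4 * n%:R - r) by rewrite mulr_ge0//; lra.
  have : 0 <= n%:R * (Z - V) by rewrite mulr_ge0//; lra.
  lra.
apply: (@lt_le_trans _ _ (n%:R / 2 *
    (mean (fun x => v x ^+ k) - 3 * (4 * m%:R - d) ^+ k))).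
  by rewrite mulr_gt0//; lra.
rewrite -(mean_cst tbN (3 * _)) -(meanB tbN)//; last exact: ucont_cst.
rewrite -(meanZ tbN); last by apply: (ucontB tbN) => //; exact: ucont_cst.
apply: (le_mean tbN) => //; last exact: (ucontM tbN).
by apply: (ucontZ tbN); apply: (ucontB tbN) => //; exact: ucont_cst.
Qed.

Lemma rspace_irreducible n (phi : G -> 'M[C]_n) :
  rep_n phi -> rep_continuous N phi ->
  (forall U : 'M[C]_n, (forall x,
    (U *m phi x <= U)%MS) -> U != 0 -> \rank U = n) ->
  degree_part Gamma phi.
Proof.
move=> phir phic irr; have [n0 _ _] := phir.
(* The radius n is chosen because defect phi x < n means Re tr (phi x) > n / 2. *)
have [|m [psi [e [psiG e0 psiphi]]]] :=
  (nbhs_rep_topology (1%g : T) _).1 (phic n%:R _).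
  by rewrite ltr0n.
have {}psiphi x : defect psi x < e -> defect phi x < n%:R.
  by move=> xe; apply: psiphi; rewrite invg1 mul1g.
have psir := Gamma_rep psiG; have psic := rspace_continuous psiG.
have [k meank] := character_mean_gt0 phir phic psir psic e0 psiphi.
have [D [Theta [ThetaG trE]]] := rspace_power k psiG.
have Thetar := Gamma_rep ThetaG; have Thetac := rspace_continuous ThetaG.
have [|B B0 intB] := intertwiner tbN Thetar Thetac phir phic.
  apply: contraTneq meank => /(congr1 (@complex.Re R)) /= mean0.
  rewrite -leNgt -[leRHS]mean0 le_eqVlt; apply/orP; left; apply/eqP.
  congr mean; apply/funext => x; rewrite trE Re_mul Re_conj /=.
  by rewrite mul0r subr0.
have [V uV intV] := schur_embedding Thetar phir B0 intB irr.
exact: rspace_subrep ThetaG n0 uV intV.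
Qed.

(** Induction on the degree: a proper invariant subspace splits phi, up to a unitary, into two
    pieces whose defects add up to that of phi, so both are continuous and in Gamma by induction. *)
Lemma rspace_complete n (phi : G -> 'M[C]_n) :
  rep_n phi -> rep_continuous N phi -> degree_part Gamma phi.
Proof.
elim/ltn_ind: n phi => n IH phi phir phic; have [n0 phiU phiM] := phir.
have [irr|] := pselect (forall U : 'M[C]_n,
    (forall x, (U *m phi x <= U)%MS) -> U != 0 -> \rank U = n).
  exact: rspace_irreducible.
move=> /existsNP[U /not_implyP[stabU /not_implyP[U0 rU]]].
pose V := schmidt (row_base U).
have uV : V \is unitarymx by rewrite schmidt_unitarymx// rank_leq_col.
have VU : (V :=: U)%MS.
  apply: eqmx_trans (eq_row_base U).
  by apply: eqmx_schmidt_free; exact: row_base_free.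
pose rho x := V *m phi x *m V^t*.
have intV x : V *m phi x = rho x *m V.
  have : (V *m phi x <= V)%MS by rewrite (eqmxMr _ VU) VU.
  by move=> /submxP[A E]; rewrite /rho E -(mulmxA A) (unitarymxP uV) mulmx1.
have r0 : (0 < \rank U)%N by rewrite lt0n mxrank_eq0.
have rn : (\rank U < n)%N by rewrite ltn_neqAle rank_leq_col andbT; exact/eqP.
(* U is forgotten and its rank becomes a variable r, so that n can be replaced by r + e in all
   types. *)
clearbody rho V; move: (\rank U) r0 rn V uV {VU} rho intV =>
  r r0 rn V uV rho intV.
clear U stabU U0 rU.
have [e [W [eD uW WV]]] := unitary_complement uV.
have e0 : (0 < e)%N by rewrite -(ltn_add2l r) eD addn0.
have en : (e < n)%N by rewrite -eD -[X in (X < _)%N]add0n ltn_add2r.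
case: _ / eD in phi phir phic phiU phiM V W uV uW WV intV rn en IH n0 *.
have [uVW phiE] := rep_sum_complement phir uV uW WV intV.
have rhor := rep_n_sub phir r0 uV intV.
have psir := rep_n_complement phir erefl uV uW WV intV e0.
have sumr := rep_n_sum rhor psir.
have defE x : defect phi x = defect rho x + defect (complement_rep phi W) x.
  by rewrite [in LHS]phiE defect_similar// defect_sum.
have rho_le x : defect rho x <= defect phi x by rewrite defE lerDl defect_ge0.
have psi_le x : defect (complement_rep phi W) x <= defect phi x.
  by rewrite defE lerDr defect_ge0.
rewrite phiE; apply: (rspace_similar rsGamma) => //;
  apply: (rspace_sum rsGamma).
  apply: IH => // d /phic; apply: filterS => x; apply: le_lt_trans;
    exact: rho_le.
apply: IH => // d /phic; apply: filterS => x; apply: le_lt_trans; exact: psi_le.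
Qed.

Lemma continuous_reps_rep_topology :
  continuous_reps (rep_topology rsGamma) = Gamma.
Proof.
apply/seteqP; split=> [[n phi] [phir phic]|[n phi] phiG].
  exact: rspace_complete.
by split; [exact: Gamma_rep|exact: rspace_continuous].
Qed.

End Duality.

(** For the converse, Peter-Weyl describes a t1-neighborhood by a t1-continuous representation; it
    is t2-continuous by assumption, so the set is also a t2-neighborhood. *)
Lemma continuous_reps_le (R : realType) (G : groupType) (t1 t2 : topology_on G)
  :
  hausdorff_tb_group_topologies G t1 -> hausdorff_tb_group_topologies G t2 ->
  (opens_of t1 `<=` opens_of t2 <-> @continuous_reps R G t1 `<=`
    @continuous_reps R G t2).
Proof.
move=> [tg1 _ tb1] [tg2 _ _]; split=> [t12 [n phi] [phir phic]|t12 O Oop].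
  split=> // e /phic; rewrite !nbhsE => -[A [Aop A1] AU].
  by exists A => //; split => //; exact: t12.
have tbN := nbhs_tb_filter tg1 tb1.
suff : @open (topologized t2) O by [].
rewrite openE => x Ox.
have O1 : nbhs (1%g : topologized t1) [set y : topologized t1 | O (x * y)%g].
  apply: (@nbhs_mull _ _ tg1 (x : topologized t1) 1%g O); rewrite mulg1.
  exact: open_nbhs_nbhs.
have [n [phi [e [phir phic e0 phiO]]]] := nbhs_rep R tbN O1.
have [_ /(_ e e0) phic2] := t12 (existT _ n phi) (conj phir phic).
have : nbhs (x : topologized t2) [set y | defect phi (x^-1 * y)%g < e].
  apply: (@nbhs_mull _ _ tg2 (x^-1)%g x [set y | defect phi y < e]).
  by rewrite mulVg.
by apply: filterS => y /phiO /=; rewrite mulVKg.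
Qed.

Theorem theorem4p2 (R : realType) (G : groupType)
    (hG : maximally_almost_periodic G) :
  exists f : topology_on G -> set (matrix_map R G),
    set_bij (hausdorff_tb_group_topologies G)
            [set Gamma | representation_space Gamma] f /\
    (forall t1 t2 : topology_on G,
       hausdorff_tb_group_topologies G t1 ->
       hausdorff_tb_group_topologies G t2 ->
       (opens_of t1 `<=` opens_of t2 <-> f t1 `<=` f t2)).
Proof.
exists (@continuous_reps R G); split; last by move=> *; exact: continuous_reps_le.
split=> [t ht|t1 t2|Gamma rsGamma].
- exact: continuous_reps_space.
- rewrite !inE => ht1 ht2 ft.
  have t12 : opens_of t1 = opens_of t2.
    apply/seteqP; split; [apply/(@continuous_reps_le R _ _ _ ht1 ht2)|
      apply/(@continuous_reps_le R _ _ _ ht2 ht1)]; by rewrite ft.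
  (* Topologies with the same open sets are equal, their other fields being proofs. *)
  case: t1 t2 t12 {ht1 ht2 ft} => [O1 T1 I1 U1] [O2 T2 I2 U2] /= O12.
  case: _ / O12 in T2 I2 U2 *; congr TopologyOn; exact: Prop_irrelevance.
- exists (rep_topology rsGamma); first exact: rep_topology_htb.
  exact: continuous_reps_rep_topology.
Qed.
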